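(* Let $p>0$ and let $\lambda$ and $\mu$ be two finite Borel measures on $\mathbb{S}^{n-1}$ such that: (1) $\lambda$ is absolutely continuous with respect to spherical Lebesgue measure; (2) $\lambda(A)>0$ for every nonempty open set $A\subset\mathbb{S}^{n-1}$; (3) $\mu$ is not concentrated in any closed hemisphere of $\mathbb{S}^{n-1}$. Then there exists a convex body $K\in\mathcal{K}^n_0$ such that $\mu=\lambda_p(K,\cdot)$.
   Context: A convex body is a compact convex subset of $\mathbb{R}^n$ with nonempty interior; $\mathcal{K}^n_0$ denotes the set of convex bodies containing the origin in their interior. For $K\in\mathcal{K}^n_0$, the support function is $h_K(x)=\max_{y\in K}\langle y,x\rangle$ and the radial function is $\rho_K(u)=\max\{t>0: tu\in K\}$, for $x,u\in\mathbb{S}^{n-1}$. For $\omega\subset\mathbb{S}^{n-1}$, the radial Gauss image is $\boldsymbol{\alpha}_K(\omega)=\{x\in\mathbb{S}^{n-1}: \langle\rho_K(u)u,x\rangle=h_K(x)\text{ for some }u\in\omega\}$. For a Borel measure $\lambda$ on $\mathbb{S}^{n-1}$ (absolutely continuous w.r.t. spherical Lebesgue measure), the Gauss image measure of $\lambda$ via $K$ is the Borel measure $\lambda(K,\omega)=\lambda(\boldsymbol{\alpha}_K(\omega))$, and for $p\in\mathbb{R}$ the $L_p$ Gauss image measure $\lambda_p(K,\cdot)$ is the Borel measure on $\mathbb{S}^{n-1}$ given by $d\lambda_p(K,\cdot)=\rho_K^p\,d\lambda(K,\cdot)$. *)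

(* Defs.v *)
From HB Require Import structures.
From mathcomp Require Import all_boot all_order all_algebra.
From mathcomp Require Import all_classical all_reals all_analysis.
Unset Printing Implicit Defensive.
Import Order.TTheory GRing.Theory Num.Theory.
Import numFieldNormedType.Exports.
Local Open Scope classical_set_scope.
Local Open Scope ring_scope.

(* Euclidean space R^n, realized as row vectors; its topology is the canonical
   (product) topology of 'rV[R]_n, which coincides with the Euclidean one. *)
Definition dotp {R : realType} {n : nat} (x y : 'rV[R]_n) : R := (x *m y^T) 0 0.

Definition usphere (R : realType) (n : nat) : set 'rV[R]_n :=
  [set u | dotp u u = 1].

(* Borel sets of R^n: the sigma-algebra generated by the open sets.
   A Borel measure on S^{n-1} is a Borel measure on R^n vanishing off S^{n-1}. *)
Definition Borel (R : realType) (n : nat) := g_sigma_algebraType (@open 'rV[R]_n).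

Definition convex_set {R : realType} {n : nat} (K : set 'rV[R]_n) : Prop :=
  forall x y, K x -> K y -> forall t : R, 0 <= t <= 1 -> K (t *: x + (1 - t) *: y).

Definition convex_body0 {R : realType} {n : nat} (K : set 'rV[R]_n) : Prop :=
  compact K /\ convex_set K /\ interior K (0 : 'rV[R]_n).

Definition supportf {R : realType} {n : nat} (K : set 'rV[R]_n) (x : 'rV[R]_n) : R :=
  sup [set dotp y x | y in K].

Definition radialf {R : realType} {n : nat} (K : set 'rV[R]_n) (u : 'rV[R]_n) : R :=
  sup [set t : R | 0 < t /\ K (t *: u)].

Definition rgauss {R : realType} {n : nat} (K : set 'rV[R]_n) (w : set 'rV[R]_n)
  : set 'rV[R]_n :=
  [set x | usphere R n x /\
     exists2 u, w u & dotp (radialf K u *: u) x = supportf K x].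

Definition box {R : realType} {n : nat} (a b : 'rV[R]_n) : set 'rV[R]_n :=
  [set x | forall i, a 0 i <= x 0 i <= b 0 i].

Definition leb_outer (R : realType) (n : nat) (A : set 'rV[R]_n) : \bar R :=
  ereal_inf [set (\sum_(0 <= k <oo) (\prod_(i < n) (ab.2 k 0 i - ab.1 k 0 i))%:E)%E
            | ab in [set ab : (nat -> 'rV[R]_n) * (nat -> 'rV[R]_n) |
                 (forall k i, ab.1 k 0 i <= ab.2 k 0 i) /\
                 A `<=` \bigcup_k box (ab.1 k) (ab.2 k)]].

(* spherical Lebesgue (outer) measure, via the cone construction:
   sigma(w) = n * Leb_n({t u : 0 < t <= 1, u in w}) *)
Definition cone01 {R : realType} {n : nat} (w : set 'rV[R]_n) : set 'rV[R]_n :=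
  [set x | exists t u, 0 < t <= 1 /\ w u /\ x = t *: u].

Definition sph_outer (R : realType) (n : nat) (w : set 'rV[R]_n) : \bar R :=
  ((n%:R)%:E * leb_outer R n (cone01 w))%E.

(* outer measure induced by a Borel measure (equals the completed measure on
   sets measurable for its completion, e.g. radial Gauss images of Borel sets). *)
Definition mouter {R : realType} {n : nat} (lam : set (Borel R n) -> \bar R)
  (A : set 'rV[R]_n) : \bar R :=
  ereal_inf [set lam B | B in [set B : set (Borel R n) | measurable B /\ A `<=` B]].

Definition gauss_image_measure {R : realType} {n : nat}
  (lam : set (Borel R n) -> \bar R) (K : set 'rV[R]_n) (w : set 'rV[R]_n) : \bar R :=
  mouter lam (rgauss K w).

(* Main.v *)
(* A body K is encoded by its support function h, restricted to the sphere;
   [conjf h u = sup_x <x,u> / h x] is then 1 / rho_K, and [conjf (conjf h) = h].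
   The wanted body minimizes

     E(h) = int ln h dlam + (1/p) int (conjf h)^p dmu

   over all conjugate functions h. The two mass hypotheses bound h from above and
   from below along a minimizing sequence (the caps on which <x,v> is bounded away
   from 0 have mass bounded away from 0), and equicontinuity gives a limit.
   Replacing g = conjf h by g * exp (t 1_O), with O open, changes the first term by
   at most -t times the lam-measure of the normals touching the body in O only, so
   minimality gives one half of the Euler-Lagrange equation g^p mu = lam(K, .) on
   open sets; rescaling g shows that both sides have the same mass, which turns the
   inequality into an equality. That lam(K, .) is a measure follows from the fact
   that almost every normal has a single contact point: the exceptional normals
   lie in countably many Lipschitz graphs. *)

Require Import Defs.
From HB Require Import structures.
From mathcomp Require Import all_boot all_order all_algebra.
From mathcomp Require Import all_classical all_reals all_analysis.
From mathcomp Require Import measurable_realfun ring lra.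
Set Implicit Arguments.
Unset Strict Implicit.
Import Order.TTheory GRing.Theory Num.Theory.
Import numFieldNormedType.Exports.
Local Open Scope classical_set_scope.
Local Open Scope ring_scope.

(** * Euclidean space and its Borel sets *)

(** Origin of [E]: if [ln g] moves by [t phi], then [ln h x] moves to first order by [- t phi u],
    where [u] is the contact direction of [x], and [g^p / p] moves by [t phi g^p]. A critical point
    thus satisfies [g^p mu = lam(K, .)], that is [mu = rho_K^p lam(K, .)]. As [p > 0], the second
    term blows up when [h] comes close to 0, faster than [ln h] drops. The energy is never
    differentiated. An upper bound on the first term is enough, so the perturbation [1_O] may be
    discontinuous; and [conjf (conjf f) <= f] lets [f = g exp (t 1_O)] serve as a competitor
    although it need not be [1 / rho] of a convex body. Each passage [t -> 0] happens in an explicit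
    inequality whose error is linear in [t]. The Gauss image of a general Borel set is measured by
    an outer measure. It is therefore enclosed between two Borel sets that differ by a null set,
    built from an almost everywhere inverse of the Gauss map. *)

Section Euclidean.
Context {R : realType} {n : nat}.
Implicit Types (x y u v : 'rV[R]_n) (a t : R).

Lemma dotpE x y : dotp x y = \sum_i x 0 i * y 0 i.
Proof. by rewrite /dotp mxE; apply: eq_bigr => i _; rewrite mxE. Qed.

Lemma dotpC x y : dotp x y = dotp y x.
Proof. by rewrite !dotpE; apply: eq_bigr => i _; rewrite mulrC. Qed.

Lemma dotpZl a x y : dotp (a *: x) y = a * dotp x y.
Proof. by rewrite /dotp -scalemxAl mxE. Qed.

Lemma dotpZr a x y : dotp x (a *: y) = a * dotp x y.
Proof. by rewrite dotpC dotpZl dotpC. Qed.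

Lemma dotpDl x y v : dotp (x + y) v = dotp x v + dotp y v.
Proof. by rewrite /dotp mulmxDl mxE. Qed.

Lemma dotpDr x y v : dotp v (x + y) = dotp v x + dotp v y.
Proof. by rewrite dotpC dotpDl !(dotpC v). Qed.

Lemma dotpBl x y v : dotp (x - y) v = dotp x v - dotp y v.
Proof. by rewrite dotpDl -scaleN1r dotpZl mulN1r. Qed.

Lemma dotpBr x y v : dotp v (x - y) = dotp v x - dotp v y.
Proof. by rewrite dotpC dotpBl !(dotpC v). Qed.

Lemma dotp_ge0 x : 0 <= dotp x x.
Proof. by rewrite dotpE; apply: sumr_ge0 => i _; rewrite -expr2 sqr_ge0. Qed.

Lemma le_coord_norm x i : `|x 0 i| <= `|x|.
Proof.
rewrite [leRHS]/Num.norm /= mx_normrE.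
by apply/bigmax_geP; right => /=; exists (0, i).
Qed.

Lemma norm_le_coord x a : 0 <= a -> (forall i, `|x 0 i| <= a) -> `|x| <= a.
Proof.
move=> a0 xa; rewrite [leLHS]/Num.norm /= mx_normrE.
by apply/bigmax_leP; split => // -[i j] _ /=; rewrite (ord1 i).
Qed.

(** The norm of a row is the sup norm, hence the factor [n], which reappears in the Lipschitz
    constants of conjugates. *)
Lemma norm_dotp_le x y : `|dotp x y| <= n%:R * `|x| * `|y|.
Proof.
rewrite dotpE (le_trans (ler_norm_sum _ _ _))//.
rewrite (@le_trans _ _ (\sum_(i < n) `|x| * `|y|))//.
  by apply: ler_sum => i _; rewrite normrM ler_pM// le_coord_norm.
by rewrite sumr_const card_ord -mulrA mulr_natl.
Qed.

Lemma usphereP x : usphere R n x -> dotp x x = 1.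
Proof. by []. Qed.

Lemma usphere_norm_le1 x : usphere R n x -> `|x| <= 1.
Proof.
move=> xS; apply: norm_le_coord => // i.
rewrite -(@ler_pXn2r _ 2) ?nnegrE// expr1n -normrX ger0_norm ?sqr_ge0//.
rewrite -(usphereP xS) dotpE (bigD1 i)//= expr2 lerDl.
by apply: sumr_ge0 => j _; rewrite -expr2 sqr_ge0.
Qed.

Lemma dotp_usphere_le1 x y : usphere R n x -> usphere R n y -> dotp x y <= 1.
Proof.
move=> /usphereP xS /usphereP yS; have := dotp_ge0 (x - y).
rewrite !(dotpBl, dotpBr) xS yS (dotpC y x) => h; lra.
Qed.

Lemma norm_dotp_usphere_le u x : usphere R n u -> `|dotp u x| <= n%:R * `|x|.
Proof.
move=> uS; rewrite (le_trans (norm_dotp_le _ _))// ler_wpM2r//.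
by rewrite ler_piMr// usphere_norm_le1.
Qed.

Lemma dotp_continuous : continuous (fun z : 'rV[R]_n * 'rV[R]_n => dotp z.1 z.2).
Proof.
rewrite (_ : (fun _ => _) =
    (fun z : 'rV[R]_n * 'rV[R]_n => \sum_(i < n) z.1 0 i * z.2 0 i)); last first.
  by apply/funext => w; rewrite dotpE.
elim: (index_enum _) => [|i r IH] z.
  by rewrite (_ : (fun _ => _) = cst 0); [exact: cvg_cst|
    by apply/funext => w; rewrite big_nil].
rewrite (_ : (fun _ => _) = (fun z : 'rV[R]_n * 'rV[R]_n => z.1 0 i * z.2 0 i
    + \sum_(j <- r) z.1 0 j * z.2 0 j)); last first.
  by apply/funext => w; rewrite big_cons.
apply: cvgD; last exact: IH.
apply: cvgM.
  apply: (@continuous_comp _ _ _ fst (fun v : 'rV[R]_n => v 0 i) z).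
    exact: cvg_fst.
  exact: coord_continuous.
apply: (@continuous_comp _ _ _ snd (fun v : 'rV[R]_n => v 0 i) z).
  exact: cvg_snd.
exact: coord_continuous.
Qed.

Lemma dotp_continuousr u : continuous (dotp u).
Proof.
move=> x; apply: (@continuous_comp _ _ _ (fun x : 'rV[R]_n => (u, x))
  (fun z : 'rV[R]_n * 'rV[R]_n => dotp z.1 z.2) x); last exact: dotp_continuous.
apply: (@cvg_pair _ _ _ (nbhs x) (nbhs u) (nbhs x) _ _ _ (cst u) id).
  exact: cvg_cst.
exact: cvg_id.
Qed.

Lemma usphere_closed : closed (usphere R n).
Proof.
rewrite (_ : usphere R n = (fun x => dotp x x) @^-1` [set 1])//.
apply: (@preimage_closed _ _ (fun x : 'rV[R]_n => dotp x x)); last first.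
  exact: (@accessible_closed_set1 R (hausdorff_accessible (@Rhausdorff R))).
move=> x _; apply: (@continuous_comp _ _ _ (fun x : 'rV[R]_n => (x, x))
  (fun z : 'rV[R]_n * 'rV[R]_n => dotp z.1 z.2) x); last exact: dotp_continuous.
by apply: (@cvg_pair _ _ _ (nbhs x) (nbhs x) (nbhs x) _ _ _ id id); exact: cvg_id.
Qed.

Lemma usphere_compact : compact (usphere R n).
Proof.
apply: bounded_closed_compact; last exact: usphere_closed.
exists 1; split=> // M M1 x xS /=.
by rewrite (le_trans (usphere_norm_le1 xS))// ltW.
Qed.

Lemma open_measurable_Borel (A : set 'rV[R]_n) :
  open A -> measurable (A : set (Borel R n)).
Proof. by move=> oA; exact: sub_sigma_algebra. Qed.

Lemma closed_measurable_Borel (A : set 'rV[R]_n) :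
  closed A -> measurable (A : set (Borel R n)).
Proof.
move=> cA; rewrite -(setCK A); apply: measurableC.
by apply: open_measurable_Borel; exact: closed_openC.
Qed.

Lemma usphere_measurable : measurable (usphere R n : set (Borel R n)).
Proof. by apply: closed_measurable_Borel; exact: usphere_closed. Qed.

Lemma continuous_measurable_Borel (f : 'rV[R]_n -> R) :
  continuous f -> measurable_fun setT (f : Borel R n -> R).
Proof.
move=> cf; apply: (measurability _ (@RGenOpens.measurableE R)).
move=> _ [_ [a [b ->] <-]]; rewrite setTI; apply: open_measurable_Borel.
by apply: open_comp; [move=> x _; exact: cf|exact: interval_open].
Qed.

End Euclidean.

(** * Conjugate functions on the sphere *)

(* If [f = 1 / rho_K] on the sphere then [conjf f] is the support function of the
   convex body [K]; if [f = h_K] then [conjf f = 1 / rho_K]. *)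
Definition conjf {R : realType} {n : nat} (f : 'rV[R]_n -> R) (x : 'rV[R]_n) : R :=
  sup [set dotp u x / f u | u in usphere R n].

(** For [f] a support function or an inverse radial function: the body lies between two balls
    centred at 0. Values off the sphere are left free, since [conjf] does not see them. *)
Definition pinched {R : realType} {n : nat} (a b : R) (f : 'rV[R]_n -> R) :=
  0 < a /\ forall u, usphere R n u -> a <= f u <= b.

Section Conjugate.
Context {R : realType} {n : nat}.
Implicit Types (f g : 'rV[R]_n -> R) (x y u v : 'rV[R]_n) (a b c t : R).
Local Notation S := (usphere R n).

Lemma pinched_gt0 a b f u : pinched a b f -> S u -> 0 < f u.
Proof. by move=> [a0 fab] /fab /andP[/(lt_le_trans a0)]. Qed.

Lemma pinched_ub_gt0 a b f u : pinched a b f -> S u -> 0 < b.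
Proof.
by move=> fab uS; have := pinched_gt0 fab uS => /lt_le_trans; apply;
  case: fab => _ /(_ _ uS) /andP[].
Qed.

Lemma conjf_has_ubound a b f x : pinched a b f ->
  has_ubound [set dotp u x / f u | u in S].
Proof.
move=> fab; exists (n%:R * `|x| / a) => _ [u uS <-].
have fu0 := pinched_gt0 fab uS; have [a0 /(_ _ uS) /andP[au _]] := fab.
rewrite (le_trans (ler_norm _))// normrM.
rewrite ler_pM// ?norm_dotp_usphere_le//.
by rewrite normfV gtr0_norm// lef_pV2// posrE.
Qed.

Lemma conjf_ub a b f x u : pinched a b f -> S u -> dotp u x / f u <= conjf f x.
Proof.
move=> fab uS; apply: ub_le_sup; first exact: conjf_has_ubound fab.
by exists u.
Qed.

(** Young's inequality for this duality. Equality means that the ray along [u] leaves the body at a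
    boundary point with outer normal [x]. *)
Lemma conjf_young a b f x u : pinched a b f -> S u ->
  dotp u x <= f u * conjf f x.
Proof.
move=> fab uS; have fu0 := pinched_gt0 fab uS.
by rewrite mulrC -ler_pdivrMr//; exact: conjf_ub fab uS.
Qed.

Lemma conjf_le f x c : S !=set0 -> (forall u, S u -> dotp u x / f u <= c) ->
  conjf f x <= c.
Proof.
move=> [u0 u0S] fc; apply: ge_sup; first by exists (dotp u0 x / f u0), u0.
by move=> _ [u uS <-]; exact: fc.
Qed.

Lemma conjf_adherent a b f x c : pinched a b f -> S x -> c < conjf f x ->
  exists2 u, S u & c < dotp u x / f u.
Proof.
move=> fab xS cf; have [] := @sup_adherent R [set dotp u x / f u | u in S] (conjf f x - c).
- by rewrite subr_gt0.
- split; last exact: conjf_has_ubound fab.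
  by exists (dotp x x / f x), x.
- by move=> _ [u uS <-]; rewrite opprB addrC subrK => h; exists u.
Qed.

(* The sphere is empty when [n = 0]. *)
Lemma pinched_conjf a b f : pinched a b f -> S !=set0 ->
  pinched b^-1 a^-1 (conjf f).
Proof.
move=> fab S0; have [a0 fb] := fab.
have b0 : 0 < b by case: S0 => u uS; exact: pinched_ub_gt0 fab uS.
split; first by rewrite invr_gt0.
move=> x xS; apply/andP; split.
  (* The lower bound comes from testing the supremum at [u = x]. *)
  apply: le_trans (conjf_ub _ fab xS).
  rewrite usphereP// div1r lef_pV2 ?posrE// ?(pinched_gt0 fab)//.
  by have /andP[] := fb _ xS.
apply: conjf_le => // u uS; have fu0 := pinched_gt0 fab uS.
have /andP[au _] := fb _ uS.
rewrite ler_pdivrMr// (le_trans (dotp_usphere_le1 uS xS))//.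
by rewrite mulrC ler_pdivlMr// mul1r.
Qed.

(** A supremum of linear functions with slopes [u / f u], which are bounded in terms of [a] alone.
    This uniformity is the equicontinuity of a minimizing sequence. *)
Lemma conjf_lipschitz a b f x y : pinched a b f ->
  `|conjf f x - conjf f y| <= n%:R / a * `|x - y|.
Proof.
move=> fab; have [a0 fb] := fab.
have [[u0 u0S]|/set0P/negP/negPn/eqP S0] := pselect (S !=set0); last first.
  by rewrite /conjf S0 !image_set0 subrr normr0 mulr_ge0// divr_ge0// ltW.
suff h z w : conjf f z <= conjf f w + n%:R / a * `|z - w|.
  rewrite ler_distl; apply/andP; split; last exact: h.
  by rewrite lerBlDr distrC.
apply: conjf_le; first by exists u0.
move=> u uS; have fu0 := pinched_gt0 fab uS; have /andP[au _] := fb _ uS.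
have := conjf_ub w fab uS.
have -> : dotp u z = dotp u w + dotp u (z - w) by rewrite dotpBr addrC subrK.
rewrite mulrDl => h; rewrite lerD//.
rewrite (le_trans (ler_norm _))// normrM mulrAC.
by rewrite ler_pM// ?norm_dotp_usphere_le// normfV gtr0_norm// lef_pV2// posrE.
Qed.

(** [conjf (conjf f)] is the support function of the Wulff shape of [f], the largest body whose
    support function is at most [f]. *)
Lemma conjf_conjf_le a b f u : pinched a b f -> S u -> conjf (conjf f) u <= f u.
Proof.
move=> fab uS; have S0 : S !=set0 by exists u.
apply: conjf_le => // x xS; have gab := pinched_conjf fab S0.
rewrite ler_pdivrMr ?(pinched_gt0 gab)// dotpC; exact: conjf_young fab uS.
Qed.

(** Monotonicity and homogeneity of degree -1 in one statement, so that multiplicative estimates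
    pass through [conjf] with the same constant. *)
Lemma conjf_anti a b f g x c : pinched a b f -> (forall u, S u -> 0 < g u) ->
  S x -> 0 < c -> (forall u, S u -> f u <= c * g u) -> conjf g x <= c * conjf f x.
Proof.
move=> fab g0 xS c0 fg; have S0 : S !=set0 by exists x.
have cf0 : 0 < conjf f x by have := pinched_gt0 (pinched_conjf fab S0) xS.
apply: conjf_le => // u uS; rewrite ler_pdivrMr ?g0//.
rewrite (le_trans (conjf_young x fab uS))//.
by rewrite mulrAC ler_wpM2r ?fg// ltW.
Qed.

(** By Young's inequality [conjf] is an antitone Galois connection with itself, so three
    applications collapse to one. *)
Lemma conjf3 a b f x : pinched a b f -> S x -> conjf (conjf (conjf f)) x = conjf f x.
Proof.
move=> fab xS; have S0 : S !=set0 by exists x.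
have gab := pinched_conjf fab S0; have hab := pinched_conjf gab S0.
apply/eqP; rewrite eq_le (conjf_conjf_le gab xS)/=.
rewrite -[leRHS]mul1r; apply: (conjf_anti hab) => // u uS.
  exact: pinched_gt0 fab uS.
by rewrite mul1r (conjf_conjf_le fab).
Qed.

End Conjugate.

(** * Finite measures on the sphere *)

Section FiniteMeasure.
Context {R : realType} {n : nat}.
Implicit Types (f g : 'rV[R]_n -> R) (A : set 'rV[R]_n).
Implicit Types (m : {measure set (Borel R n) -> \bar R}).
Local Notation S := (usphere R n).

Lemma lipschitz_continuous f (L : R) :
  (forall x y, `|f x - f y| <= L * `|x - y|) -> continuous f.
Proof.
move=> fL x.
apply/(@cvgrPdist_lt _ _ _ (nbhs (x : 'rV[R]_n)) _ f (f x)) => e e0.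
have L1 : 0 < `|L| + 1 by rewrite ltr_wpDl.
near=> y; rewrite (le_lt_trans (fL _ _))//.
rewrite (@le_lt_trans _ _ ((`|L| + 1) * `|x - y|))//.
  by rewrite ler_wpM2r// (le_trans (ler_norm _))// lerDl.
rewrite mulrC -ltr_pdivlMr//; near: y.
by apply: cvgr_dist_lt; [exact: cvg_id|rewrite divr_gt0].
Unshelve. all: by end_near. Qed.

Lemma finite_Borel m A : (m setT < +oo)%E -> measurable (A : set (Borel R n)) ->
  (m A < +oo)%E.
Proof.
move=> mfin mA; apply: le_lt_trans mfin.
by apply: le_measure; rewrite ?inE.
Qed.

Lemma finite_Borel_fin_num m A : (m setT < +oo)%E ->
  measurable (A : set (Borel R n)) -> m A \is a fin_num.
Proof. by move=> mfin mA; rewrite ge0_fin_numE// finite_Borel. Qed.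

Lemma le_fine_measure m (A B : set 'rV[R]_n) : (m setT < +oo)%E ->
  measurable (A : set (Borel R n)) -> measurable (B : set (Borel R n)) ->
  A `<=` B -> fine (m A) <= fine (m B).
Proof.
move=> mfin mA mB AB; apply: fine_le; rewrite ?finite_Borel_fin_num//.
by apply: le_measure; rewrite ?inE.
Qed.

Lemma measure_bigcup_null m (F : nat -> set 'rV[R]_n) :
  (forall k, measurable (F k : set (Borel R n))) ->
  (forall k, m (F k) = 0%E) -> m (\bigcup_k F k) = 0%E.
Proof.
move=> mF F0; apply: measure_negligible; first exact: bigcupT_measurable.
by apply: negligible_bigcup => k; exists (F k); split.
Qed.

Lemma bounded_integrable_usphere m f (M : R) : (m setT < +oo)%E ->
  measurable_fun setT (f : Borel R n -> R) ->
  (forall x, S x -> `|f x| <= M) -> m.-integrable S (EFin \o f).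
Proof.
move=> mfin mf fM; apply: measurable_bounded_integrable.
- exact: usphere_measurable.
- by apply: finite_Borel => //; exact: usphere_measurable.
- exact: measurable_funTS.
- exists M; split; first exact: num_real.
  by move=> N MN x xS /=; rewrite (le_trans (fM _ xS))// ltW.
Qed.

Lemma open_cap_measurable (v : 'rV[R]_n) (c : R) :
  measurable (S `&` [set x | c < dotp x v] : set (Borel R n)).
Proof.
apply: measurableI; first exact: usphere_measurable.
apply: open_measurable_Borel.
rewrite (_ : [set x | _] = dotp v @^-1` `]c, +oo[%classic).
  by apply: open_comp => [x _|]; [exact: dotp_continuousr|exact: interval_open].
by apply/seteqP; split => x /=; rewrite in_itv/= andbT dotpC.
Qed.

(* Compactness makes the positivity of the mass of open hemispheres uniform. *)
Lemma uniform_cap_mass m : (m setT < +oo)%E ->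
  (forall v, S v -> (0 < m (S `&` [set x | (0 < dotp x v)%R]))%E) ->
  exists2 d : R, 0 < d & forall v, S v ->
    d <= fine (m (S `&` [set x | d < dotp x v])).
Proof.
move=> mfin mpos.
(* The same [d] is the height of the cap and the bound on its mass: lowering it weakens both
   requirements. *)
suff: \forall d \near 0^'+, S `<=` [set v |
    d <= fine (m (S `&` [set x | d < dotp x v]))].
  move=> h.
  by have [d [/= d0 dS]] := filter_ex (filterI (nbhs_right_gt (0 : R)) h); exists d.
have /compact_near_coveringP := @usphere_compact R n; apply => v vS.
have [k mk] : exists k : nat,
    (0 < m (S `&` [set x | (k.+1%:R^-1 < dotp x v)%R]))%E.
  apply: contrapT => /forallNP k0.
  have := mpos _ vS; suff -> : m (S `&` [set x | (0 < dotp x v)%R]) = 0%E.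
    by rewrite ltxx.
  rewrite (_ : _ `&` _ =
      \bigcup_k (S `&` [set x | (k.+1%:R^-1 < dotp x v)%R])); last first.
    apply/seteqP; split => [x [xS /= x0]|x [k _ [xS /= xk]]]; last first.
      by split => //=; rewrite (lt_trans _ xk)// invr_gt0.
    have := archi_boundP (ltW (_ : 0 < (dotp x v)^-1)).
    rewrite invr_gt0 => /(_ x0); set k := Num.bound _ => xk.
    exists k => //; split => //=; rewrite invf_plt ?posrE//.
    by rewrite (lt_trans xk)// ltr_nat.
  apply: measure_bigcup_null => k; first exact: open_cap_measurable.
  apply/eqP; rewrite eq_le measure_ge0 andbT leNgt.
  by apply/negP => h; exact: (k0 k).
set A := S `&` _ in mk; set c : R := k.+1%:R^-1 in A mk.
have c0 : 0 < c by rewrite invr_gt0.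
have mA : measurable (A : set (Borel R n)) by exact: open_cap_measurable.
have q0 : 0 < fine (m A) by rewrite fine_gt0// mk/= finite_Borel.
(* The cap of height [c] about [v] lies in the cap of height [d] about [v'] once [d] and the
   variation of [dotp x] from [v] to [v'] are both below [c / 2]. *)
near=> v' d.
have dq : d <= fine (m A) by near: d; exact: nbhs_right_le.
rewrite /= (le_trans dq)//; apply: le_fine_measure => //.
  exact: open_cap_measurable.
move=> x [xS /= cx]; split => //=.
have dc : d < c / 2 by near: d; apply: nbhs_right_lt; rewrite divr_gt0.
have vv : n%:R * `|v - v'| < c / 2.
  have n0 : 0 < n%:R + 1 :> R by rewrite ltr_wpDl.
  rewrite (@le_lt_trans _ _ ((n%:R + 1) * `|v - v'|)) ?ler_wpM2r ?lerDl//.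
  rewrite mulrC -ltr_pdivlMr//; near: v'.
  by apply: cvgr_dist_lt; [exact: cvg_id|rewrite !divr_gt0].
have := le_lt_trans (norm_dotp_usphere_le (v - v') xS) vv.
rewrite dotpBr ltr_norml => /andP[_]; lra.
Unshelve. all: by end_near. Qed.

End FiniteMeasure.

(** * The energy and the integrability of its terms *)

Definition energy {R : realType} {n : nat}
  (lam mu : {measure set (Borel R n) -> \bar R}) (p : R) (h : 'rV[R]_n -> R) : R :=
  \int[lam]_(x in usphere R n) ln (h x)
  + p^-1 * \int[mu]_(u in usphere R n) (conjf h u) `^ p.

Section Integrals.
Context {R : realType} {n : nat}.
Implicit Types (f g h : 'rV[R]_n -> R) (A : set 'rV[R]_n) (c k p a b : R).
Variable m : {measure set (Borel R n) -> \bar R}.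
Hypothesis mfin : (m setT < +oo)%E.
Local Notation S := (usphere R n).
Local Notation intS f := (m.-integrable S (EFin \o f)).

Lemma integrable_cst_indic c k A : measurable (A : set (Borel R n)) ->
  intS (fun x => c + k * \1_A x).
Proof.
move=> mA; apply: (@bounded_integrable_usphere _ _ m _ (`|c| + `|k|)) => //.
  apply: measurable_funD => //; apply: measurable_funM => //.
move=> x _; rewrite (le_trans (ler_normD _ _))// lerD// normrM ler_piMr//=.
by rewrite indicE; case: (_ \in _); rewrite ?normr1 ?normr0.
Qed.

Lemma Rintegral_cst_indic c k A : measurable (A : set (Borel R n)) ->
  \int[m]_(x in S) (c + k * \1_A x) = c * fine (m S) + k * fine (m (S `&` A)).
Proof.
move=> mA; have mS := @usphere_measurable R n.
have i1 : intS (\1_A).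
  have := integrable_cst_indic 0 1 mA.
  by apply: eq_integrable => // x _ /=; rewrite add0r mul1r.
have ik : intS (fun x => k * \1_A x).
  have := integrable_cst_indic 0 k mA.
  by apply: eq_integrable => // x _ /=; rewrite add0r.
have ic : intS (fun=> c).
  by apply: (bounded_integrable_usphere (M := `|c|)).
rewrite RintegralD// Rintegral_cst// RintegralZl//; congr (_ + _ * _).
by rewrite /Rintegral integral_indic// setIC.
Qed.

(** The lower bounds on the energy all come from functions with two values, one of them taken on a
    cap; [k = 0] gives the constant bounds. *)
Lemma Rintegral_ge_indic f c k A : intS f -> measurable (A : set (Borel R n)) ->
  (forall x, S x -> c + k * \1_A x <= f x) ->
  c * fine (m S) + k * fine (m (S `&` A)) <= \int[m]_(x in S) f x.
Proof.
move=> fi mA cf; rewrite -Rintegral_cst_indic//; apply: le_Rintegral => //.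
- exact: usphere_measurable.
- exact: integrable_cst_indic.
Qed.

Lemma integrable_ln a b h : pinched a b h -> continuous h ->
  intS (fun x => ln (h x)).
Proof.
move=> hab hc; apply: (bounded_integrable_usphere (M := `|ln a| + `|ln b|)) => //.
  apply: measurableT_comp; first exact: measurable_ln.
  exact: continuous_measurable_Borel.
move=> x xS; have [a0 /(_ _ xS) /andP[ah hb]] := hab.
have h0 := pinched_gt0 hab xS; have b0 := pinched_ub_gt0 hab xS.
have l1 : ln a <= ln (h x) by rewrite ler_ln.
have l2 : ln (h x) <= ln b by rewrite ler_ln.
have n1 := ler_norm (- ln a); have n2 := ler_norm (ln b).
have n3 := normr_ge0 (ln a); have n4 := normr_ge0 (ln b).
rewrite normrN in n1; rewrite ler_norml; apply/andP; split; lra.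
Qed.

Lemma integrable_powR a b g p : 0 < p -> pinched a b g ->
  measurable_fun setT (g : Borel R n -> R) -> intS (fun x => g x `^ p).
Proof.
move=> p0 gab gm; apply: (bounded_integrable_usphere (M := b `^ p)) => //.
  by apply: (measurableT_comp (measurable_powR p)).
move=> x xS; have [a0 /(_ _ xS) /andP[ag gb]] := gab.
have g0 := ltW (pinched_gt0 gab xS).
rewrite ger0_norm ?powR_ge0// ge0_ler_powR// ?nnegrE ?ltW//.
exact: pinched_ub_gt0 gab xS.
Qed.

End Integrals.

(** * Coercivity of the energy *)

Section Coercivity.
Context {R : realType} {n : nat}.
Implicit Types (f g h : 'rV[R]_n -> R) (a b : R).
Variables (lam mu : {measure set (Borel R n) -> \bar R}) (p : R).
Hypothesis p0 : 0 < p.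
Hypotheses (lam_fin : (lam setT < +oo)%E) (mu_fin : (mu setT < +oo)%E).
Local Notation S := (usphere R n).

Lemma conjf_continuous a b f : pinched a b f -> continuous (conjf f).
Proof. by move=> fab; apply: lipschitz_continuous => x y; exact: conjf_lipschitz fab. Qed.

(** Half of the exponent is spent on the logarithm: with [q = p / 2] and [z = y^q >= 1],
    [ln y <= z / q] turns the hypothesis into [A z^2 <= (|J| + L / q) z]. *)
Lemma ln_le_powR_coercive (L A J : R) : 0 <= L -> 0 < A ->
  exists2 M : R, 1 <= M & forall y, 0 < y -> - L * ln y + A * y `^ p <= J -> y <= M.
Proof.
move=> L0 A0; set q := p / 2.
have q0 : 0 < q by rewrite divr_gt0.
set Q := (`|J| + L / q) / A.
have Q0 : 0 <= Q by rewrite divr_ge0 ?addr_ge0 ?divr_ge0// ltW.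
exists (Num.max 1 (Q `^ q^-1)); first by rewrite le_max lexx.
move=> y y0 yJ; rewrite le_max; have [y1|y1] := leP y 1; first by [].
apply/orP; right.
set z := y `^ q; have z0 : 0 < z by rewrite powR_gt0.
have z1 : 1 <= z.
  have -> : 1 = 1 `^ q :> R by rewrite powR1.
  by rewrite ge0_ler_powR ?nnegrE ?ltW.
have lnz : ln y <= z / q.
  rewrite ler_pdivlMr// mulrC -ln_powR ltW// ln_sublinear//.
have zz : y `^ p = z * z.
  by rewrite /z -powRD ?gt_eqF ?implybT// /q -splitr.
have zQ : z <= Q.
  rewrite /Q ler_pdivlMr// -(ler_pM2r z0).
  have h1 : L * ln y <= L * (z / q) by rewrite ler_wpM2l.
  have h2 : `|J| <= `|J| * z by rewrite ler_peMr.
  have h3 := ler_norm J.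
  rewrite mulrDl; move: yJ; rewrite zz.
  have -> : L / q * z = L * (z / q) by rewrite mulrAC mulrA.
  have -> : z * A * z = A * (z * z) by rewrite mulrAC mulrC.
  lra.
have -> : y = z `^ q^-1.
  by rewrite /z -powRrM divff ?gt_eqF// powRr1// ltW.
by rewrite ge0_ler_powR ?nnegrE ?invr_ge0 ?(ltW q0) ?(ltW z0).
Qed.

Hypothesis lam_pos : forall v, S v -> (0 < lam (S `&` [set x | (0 < dotp x v)%R]))%E.
Hypothesis mu_pos : forall v, S v -> (0 < mu (S `&` [set x | (0 < dotp x v)%R]))%E.

(** Let [y] be the supremum of [1 / h] and [x1] a point reaching half of it. On the cap about [x1],
    [conjf h u >= dotp u x1 / h x1 >= d * y / 2], while [ln h >= - ln y] everywhere; so the energy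
    is at least [- lam(S) ln y + p^-1 d (d / 2)^p y^p]. *)
Lemma energy_coercive_lower (J : R) : exists2 M : R, 1 <= M &
  forall a b h, pinched a b h -> continuous h -> energy lam mu p h <= J ->
  forall x, S x -> M^-1 <= h x.
Proof.
have [d d0 dcap] := uniform_cap_mass mu_fin mu_pos.
have A0 : 0 < p^-1 * d * (d / 2) `^ p.
  by rewrite !mulr_gt0 ?invr_gt0// powR_gt0// divr_gt0.
have [M M1 HM] := ln_le_powR_coercive J (fine_ge0 (measure_ge0 lam S)) A0.
exists M => // a b h hab hc hJ x xS.
have S0 : S !=set0 by exists x.
have h0 := pinched_gt0 hab; have [a0 hb] := hab.
set Y := [set (h z)^-1 | z in S]; set y := sup Y.
have Yub : has_ubound Y.
  exists a^-1 => _ [z zS <-]; rewrite lef_pV2 ?posrE ?h0//.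
  by have /andP[] := hb _ zS.
have Yle z : S z -> (h z)^-1 <= y by move=> zS; apply: ub_le_sup => //; exists z.
have y0 : 0 < y by apply: lt_le_trans (Yle _ xS); rewrite invr_gt0 h0.
suff yM : y <= M.
  rewrite -[leRHS]invrK lef_pV2 ?posrE ?invr_gt0 ?h0//.
    by rewrite (le_trans (Yle _ xS)).
  by rewrite (lt_le_trans _ M1).
apply: HM => //; apply: le_trans hJ.
have [x1 x1S x1y] : exists2 x1, S x1 & y / 2 < (h x1)^-1.
  have y20 : 0 < y / 2 by rewrite divr_gt0.
  have [] := @sup_adherent R Y (y / 2) y20.
    by split => //; exists (h x)^-1, x.
  move=> _ [x1 x1S <-]; rewrite -/y => h1; exists x1 => //.
  by move: h1; rewrite {1}(splitr y) addrK.
have gab := pinched_conjf hab S0.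
have gi := integrable_powR mu_fin p0 gab (continuous_measurable_Borel (conjf_continuous hab)).
rewrite /energy lerD//.
  have := Rintegral_ge_indic lam_fin (c := - ln y) (k := 0) (A := set0)
    (integrable_ln lam_fin hab hc) measurable0.
  rewrite mul0r addr0 mulNr mulrC mulNr; apply => z zS; rewrite mul0r addr0.
  rewrite -lnV ?posrE// ler_ln ?posrE ?invr_gt0 ?h0//.
  by rewrite -[leRHS]invrK lef_pV2 ?posrE ?invr_gt0 ?h0// Yle.
rewrite -!mulrA ler_wpM2l ?invr_ge0 ?(ltW p0)//.
have -> : d * ((d / 2) `^ p * y `^ p) = (d * (y / 2)) `^ p * d.
  rewrite -powRM ?(ltW y0) ?divr_ge0 ?(ltW d0)// mulrC; congr (_ `^ _ * _).
  by rewrite mulrAC mulrA.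
have mC := open_cap_measurable x1 d.
have := Rintegral_ge_indic mu_fin (c := 0) (k := (d * (y / 2)) `^ p) gi mC.
rewrite mul0r add0r setIA setIid => hge; apply: le_trans (hge _).
  by rewrite ler_wpM2l ?powR_ge0 ?dcap.
move=> u uS; rewrite add0r indicE; have [|] := boolP (u \in _); last first.
  by rewrite mulr0 powR_ge0.
rewrite inE => -[_ /= du]; rewrite mulr1 ge0_ler_powR ?nnegrE ?(ltW p0)//.
- by rewrite mulr_ge0 ?(ltW d0)// divr_ge0// ltW.
- exact: ltW (pinched_gt0 gab uS).
- apply: le_trans (conjf_ub _ hab x1S); rewrite ler_pM ?(ltW d0) ?(ltW x1y)//.
    by rewrite divr_ge0// ltW.
  by rewrite dotpC ltW.
Qed.

(** Biconjugacy forbids [h] to be large near one point only: if [u] nearly realizes [h x] as a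
    conjugate of [conjf h], then [h z >= dotp z u / conjf h u >= d * h x / 2] on the whole cap about
    [u], whose [lam]-mass is at least [d]. Elsewhere [ln h >= - ln M]. *)
Lemma energy_coercive_upper (J M : R) : 1 <= M -> exists B : R,
  forall a b h, pinched a b h -> continuous h -> energy lam mu p h <= J ->
  (forall x, S x -> M^-1 <= h x) -> (forall x, S x -> conjf (conjf h) x = h x) ->
  forall x, S x -> h x <= B.
Proof.
move=> M1; have [d d0 dcap] := uniform_cap_mass lam_fin lam_pos.
have M0 : 0 < M by rewrite (lt_le_trans _ M1).
have L0 : 0 <= fine (lam S) by rewrite fine_ge0.
have lM0 : 0 <= ln M by rewrite ln_ge0.
pose Q := (`|J| + fine (lam S) * ln M) / d.
have Q0 : 0 <= Q by rewrite divr_ge0 ?addr_ge0 ?mulr_ge0// ltW.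
exists (2 / d * expR Q) => a b h hab hc hJ hM hcc x xS.
have S0 : S !=set0 by exists x.
have h0 := pinched_gt0 hab; have gab := pinched_conjf hab S0.
have hx2 : h x / 2 < conjf (conjf h) x.
  by rewrite hcc// ltr_pdivrMr// ltr_pMr ?h0// ltr1n.
have [u uS hu] := conjf_adherent gab xS hx2.
have g0 := pinched_gt0 gab uS.
have hu1 : h x / 2 <= (conjf h u)^-1.
  rewrite (le_trans (ltW hu))// -[leRHS]mul1r ler_wpM2r ?invr_ge0 ?(ltW g0)//.
  exact: dotp_usphere_le1.
pose k := d * (h x / 2).
have k0 : 0 < k by rewrite mulr_gt0// divr_gt0// h0.
suff kQ : k <= expR Q.
  rewrite mulrAC ler_pdivlMr//.
  by move: kQ; rewrite /k; lra.
have [k1|k1] := leP k 1.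
  by rewrite (le_trans k1)// -expR0 ler_expR.
have lk0 : 0 < ln k by rewrite ln_gt0.
suff : ln k <= Q by rewrite -ler_expR lnK ?posrE.
rewrite ler_pdivlMr//.
have mC := open_cap_measurable u d.
have := Rintegral_ge_indic lam_fin (c := - ln M) (k := ln k)
  (integrable_ln lam_fin hab hc) mC.
rewrite setIA setIid => /(_ _) h1.
have {h1} h1 : - ln M * fine (lam S) + ln k * fine (lam (S `&` [set x | d < dotp x u]))
    <= \int[lam]_(x in S) ln (h x).
  apply: h1 => z zS; rewrite indicE; have [|_] := boolP (z \in _).
    rewrite inE => -[_ /= du]; rewrite mulr1 (@le_trans _ _ (ln k))//.
      by rewrite gerDr lerNl oppr0.
    rewrite ler_ln ?posrE ?h0// -(hcc _ zS).
    apply: le_trans (conjf_ub _ gab uS).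
    rewrite ler_pM ?(ltW d0) ?hu1//.
      by rewrite divr_ge0// ltW// h0.
    by rewrite dotpC ltW.
  by rewrite mulr0 addr0 -lnV ?posrE// ler_ln ?posrE ?invr_gt0 ?h0// hM.
have h2 : 0 <= p^-1 * \int[mu]_(u in S) (conjf h u) `^ p.
  rewrite mulr_ge0 ?invr_ge0 ?(ltW p0)//.
  by apply: Rintegral_ge0 => z _; exact: powR_ge0.
have h3 : ln k * d <= ln k * fine (lam (S `&` [set x | d < dotp x u])).
  by rewrite ler_wpM2l ?(ltW lk0)// dcap.
have h4 := ler_norm J.
move: hJ; rewrite /energy; lra.
Qed.

Lemma energy_coercive (J : R) : exists a b : R, 0 < a /\
  forall a' b' h, pinched a' b' h -> continuous h ->
  (forall x, S x -> conjf (conjf h) x = h x) ->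
  energy lam mu p h <= J -> pinched a b h.
Proof.
have [M M1 HM] := energy_coercive_lower J.
have [B HB] := energy_coercive_upper J M1.
have M0 : 0 < M^-1 by rewrite invr_gt0 (lt_le_trans _ M1).
exists M^-1, B; split => // a b h hab hc hcc hJ; split => // x xS.
have hM := HM _ _ _ hab hc hJ.
by rewrite hM//= (HB _ _ _ hab hc hJ).
Qed.

End Coercivity.

(** The equation holds on the whole space, so [h] is the homogeneous support function and is
    continuous everywhere, not only along the sphere. *)
Definition is_conjf {R : realType} {n : nat} (h : 'rV[R]_n -> R) :=
  exists a b f, pinched a b f /\ h = conjf f.

(** * Existence of a minimizer *)

Section Minimizer.
Context {R : realType} {n : nat}.
Implicit Types (f g h : 'rV[R]_n -> R) (a b : R).
Variables (lam mu : {measure set (Borel R n) -> \bar R}) (p : R).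
Hypothesis p0 : 0 < p.
Hypotheses (lam_fin : (lam setT < +oo)%E) (mu_fin : (mu setT < +oo)%E).
Local Notation S := (usphere R n).

Lemma expR_le_inv1B (y : R) : y < 1 -> expR y <= (1 - y)^-1.
Proof.
move=> y1; rewrite -[leLHS]invrK lef_pV2 ?posrE ?invr_gt0 ?expR_gt0 ?subr_gt0//.
by rewrite -expRN; exact: expR_ge1Dx.
Qed.

Lemma conjf0 f : conjf f 0 = 0.
Proof.
have [S0|/set0P/negP/negPn/eqP S0] := pselect (S !=set0); last first.
  by rewrite /conjf S0 image_set0 sup0.
have E u : S u -> dotp u 0 / f u = 0.
  by move=> _; rewrite -(scale0r (0 : 'rV[R]_n)) dotpZr !mul0r.
rewrite /conjf (_ : [set _ | _ in _] = [set 0]) ?sup1//.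
apply/seteqP; split => [_ [u uS <-]|_ ->]; first by rewrite E.
by have [u uS] := S0; exists u => //; exact: E.
Qed.

Lemma eq_conjf f g : (forall x, S x -> f x = g x) -> conjf f = conjf g.
Proof.
move=> fg; apply/funext => x; congr sup.
by apply/seteqP; split => _ [u uS <-]; exists u => //; rewrite fg.
Qed.

Lemma eq_energy f g : (forall x, S x -> f x = g x) ->
  energy lam mu p f = energy lam mu p g.
Proof.
move=> fg; rewrite /energy (eq_conjf fg); congr (_ + _).
by apply: eq_Rintegral => x; rewrite inE => xS; rewrite fg.
Qed.

Lemma is_conjf_pinched h : is_conjf h -> exists a b, pinched a b h.
Proof.
move=> [a [b [f [fab ->]]]].
have [S0|S0] := pselect (S !=set0).
  by exists b^-1, a^-1; exact: pinched_conjf.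
by exists 1, 1; split => // u uS; exfalso; apply: S0; exists u.
Qed.

Lemma is_conjf_continuous h : is_conjf h -> continuous h.
Proof. by move=> [a [b [f [fab ->]]]]; exact: conjf_continuous fab. Qed.

Lemma is_conjf_conjf2 h x : is_conjf h -> S x -> conjf (conjf h) x = h x.
Proof. by move=> [a [b [f [fab ->]]]] xS; exact: conjf3 fab xS. Qed.

(** Closeness is multiplicative because a factor [expR eta] moves [ln h] by [eta] and [(conjf h)^p]
    by a factor [expR (p * eta)]; the resulting error depends on [h] and [h'] only through [a]. *)
Lemma energy_continuity a b h h' (eta : R) :
  pinched a b h -> pinched a b h' -> continuous h -> continuous h' -> 0 < eta ->
  (forall x, S x -> h x <= expR eta * h' x) ->
  (forall x, S x -> h' x <= expR eta * h x) ->
  energy lam mu p h <= energy lam mu p h' + eta * fine (lam S)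
    + p^-1 * ((expR (p * eta) - 1) * (a^-1 `^ p * fine (mu S))).
Proof.
move=> hab hab' hc hc' eta0 hh' h'h; have [a0 _] := hab.
have mS := @usphere_measurable R n.
have [S0|/set0P/negP/negPn/eqP S0] := pselect (S !=set0); last first.
  by rewrite /energy S0 !Rintegral_set0 !measure0 /= !mulr0 !addr0.
have gab := pinched_conjf hab S0; have gab' := pinched_conjf hab' S0.
have gi := integrable_powR mu_fin p0 gab
  (continuous_measurable_Borel (conjf_continuous hab)).
have gi' := integrable_powR mu_fin p0 gab'
  (continuous_measurable_Borel (conjf_continuous hab')).
have li := integrable_ln lam_fin hab hc.
have li' := integrable_ln lam_fin hab' hc'.
have ic : lam.-integrable S (EFin \o (fun=> eta)).
  by apply: (bounded_integrable_usphere (M := `|eta|)).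
have h1 : \int[lam]_(x in S) ln (h x) <=
    \int[lam]_(x in S) ln (h' x) + eta * fine (lam S).
  rewrite -(Rintegral_cst lam mS) -RintegralD//; apply: le_Rintegral => //.
    by have := integrableD mS li' ic; apply: eq_integrable.
  move=> x xS; have h0 := pinched_gt0 hab xS; have h0' := pinched_gt0 hab' xS.
  rewrite -[eta]expRK -lnM ?posrE ?expR_gt0// ler_ln ?posrE//.
    by rewrite mulrC hh'.
  by rewrite mulr_gt0// expR_gt0.
have h2 : \int[mu]_(u in S) conjf h u `^ p <=
    expR (p * eta) * \int[mu]_(u in S) conjf h' u `^ p.
  rewrite -RintegralZl//; apply: le_Rintegral => //.
    by have := integrableZl mS (expR (p * eta)) gi'; apply: eq_integrable.
  move=> u uS; have g0 := ltW (pinched_gt0 gab uS).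
  have g0' := ltW (pinched_gt0 gab' uS).
  rewrite [p * eta]mulrC expRM -powRM ?expR_ge0// ge0_ler_powR ?nnegrE ?(ltW p0)//.
    by rewrite mulr_ge0// expR_ge0.
  by apply: (conjf_anti hab') => // [v vS|]; rewrite ?expR_gt0// (pinched_gt0 hab).
have h3 : \int[mu]_(u in S) conjf h' u `^ p <= a^-1 `^ p * fine (mu S).
  rewrite -(Rintegral_cst mu mS); apply: le_Rintegral => //.
    by apply: (bounded_integrable_usphere (M := `|a^-1 `^ p|)).
  move=> u uS; have [_ /(_ _ uS) /andP[_ gb]] := gab'.
  rewrite ge0_ler_powR ?nnegrE ?(ltW p0)// ?invr_ge0 ?(ltW a0)//.
  exact: ltW (pinched_gt0 gab' uS).
have e1 : 0 <= expR (p * eta) - 1.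
  by rewrite subr_ge0 -expR0 ler_expR mulr_ge0 ?ltW.
rewrite /energy.
have h4 : (expR (p * eta) - 1) * \int[mu]_(u in S) conjf h' u `^ p <=
  (expR (p * eta) - 1) * (a^-1 `^ p * fine (mu S)) by rewrite ler_wpM2l.
have h5 : p^-1 * \int[mu]_(u in S) conjf h u `^ p <=
    p^-1 * \int[mu]_(u in S) conjf h' u `^ p +
    p^-1 * ((expR (p * eta) - 1) * (a^-1 `^ p * fine (mu S))).
  rewrite -mulrDr ler_wpM2l ?invr_ge0 ?(ltW p0)//.
  apply: (le_trans h2); rewrite -{1}[expR _](subrK 1) mulrDl mul1r addrC.
  by rewrite lerD2l.
apply: le_trans (lerD h1 h5) _.
by rewrite addrA [X in X + _ <= _]addrAC.
Qed.

(* A cluster point for pointwise convergence is a uniform cluster point, by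
   equicontinuity; this replaces the Blaschke selection theorem. *)
Lemma equilipschitz_cluster (H : nat -> 'rV[R]_n -> R) (L : R) : 0 <= L ->
  (forall k x y, `|H k x - H k y| <= L * `|x - y|) -> (forall k, H k 0 = 0) ->
  exists h, (forall x y, `|h x - h y| <= L * `|x - y|) /\
    forall (e : R) N, 0 < e -> exists2 k, (N <= k)%N &
      forall x, S x -> `|H k x - h x| < e.
Proof.
move=> L0 HL H0.
pose T : topologicalType :=
  prod_topology (fun _ : 'rV[R]_n => R : topologicalType).
(* The value at [x] is confined to an interval because all [H k] vanish at 0; compactness of the
   product is Tychonoff's theorem. *)
pose A : set T := [set f : T | forall x, `[- (L * `|x|), L * `|x|]%classic (f x)].
have cA : compact A.
  apply: (@tychonoff 'rV[R]_n (fun=> R : topologicalType)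
    (fun x => `[- (L * `|x|), L * `|x|]%classic)) => x.
  exact: segment_compact.
have FA : nbhs ((H : nat -> T) @ \oo) A.
  exists 0%N => // k _ x /=; rewrite in_itv/= -ler_norml.
  by have := HL k x 0; rewrite H0 !subr0.
have [h [Ah clh]] := cA ((H : nat -> T) @ \oo) _ FA.
have freq (U : set T) N : nbhs h U -> exists2 k, (N <= k)%N & U (H k).
  move=> hU; have [] := clh [set H k | k in [set k | (N <= k)%N]] U _ hU.
    by exists N => // k /= Nk; exists k.
  by move=> _ [[k /= Nk <-] Uk]; exists k.
have nearh x e : 0 < e -> nbhs h [set f : T | `|f x - h x| < e].
  move=> e0; have := @proj_continuous _ (fun _ : 'rV[R]_n => R : topologicalType) x h.
  move=> /(_ [set y | `|y - h x| < e]); apply.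
  have := @nbhsx_ballx _ R (h x) e e0; apply: filterS => y.
  by rewrite /ball/= distrC.
have hL x y : `|h x - h y| <= L * `|x - y|.
  apply/ler_addgt0Pr => e e0; have e20 : 0 < e / 2 by rewrite divr_gt0.
  have [k _ [/= kx ky]] := freq _ 0%N (filterI (nearh x _ e20) (nearh y _ e20)).
  have := HL k x y; move: kx ky; rewrite !ltr_norml => /andP[? ?] /andP[? ?].
  rewrite !ler_norml => /andP[? ?]; apply/andP; split; lra.
exists h; split => // e N e0.
(* The Lipschitz bound is a premise inside the set: pointwise neighbourhoods of [h] also contain
   functions that violate it, but every [H k] satisfies it. *)
suff : nbhs h [set f : T | forall x, S x ->
    (forall y z, `|f y - f z| <= L * `|y - z|) -> `|f x - h x| < e].
  by move=> /(freq _ N)[k Nk /= kS]; exists k => // x xS; exact: kS.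
have /compact_near_coveringP /(_ T (nbhs h)
  (fun f x => (forall y z, `|f y - f z| <= L * `|y - z|) -> `|f x - h x| < e)) :=
  @usphere_compact R n.
apply => x xS.
have L1 : 0 < 3 * (L + 1) by rewrite mulr_gt0// ltr_wpDl.
have e3 : 0 < e / 3 by rewrite divr_gt0.
near=> x' f => /= fL.
have fx : `|f x - h x| < e / 3 by near: f; exact: nearh.
have xx : `|x - x'| < e / (3 * (L + 1)).
  by near: x'; apply: cvgr_dist_lt; [exact: cvg_id|rewrite divr_gt0].
have Lxx : L * `|x - x'| < e / 3.
  rewrite (@le_lt_trans _ _ ((L + 1) * `|x - x'|)) ?ler_wpM2r ?lerDl//.
  by move: xx; rewrite invfM mulrA ltr_pdivlMr 1?mulrC// ltr_wpDl.
have := fL x x'; have := hL x x'; move: fx; rewrite !ltr_norml !ler_norml.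
move=> /andP[? ?] /andP[? ?] /andP[? ?]; apply/andP; split; lra.
Unshelve. all: by end_near. Qed.

End Minimizer.

Section MinimizerExistence.
Context {R : realType} {n : nat}.
Variables (lam mu : {measure set (Borel R n) -> \bar R}) (p : R).
Hypothesis p0 : 0 < p.
Hypotheses (lam_fin : (lam setT < +oo)%E) (mu_fin : (mu setT < +oo)%E).
Local Notation S := (usphere R n).
Hypothesis lam_pos : forall v, S v -> (0 < lam (S `&` [set x | (0 < dotp x v)%R]))%E.
Hypothesis mu_pos : forall v, S v -> (0 < mu (S `&` [set x | (0 < dotp x v)%R]))%E.

Lemma expR_sub1_le (y : R) : 0 <= y -> y <= 2^-1 -> expR y - 1 <= 2 * y.
Proof.
move=> y0 y2; have y1 : y < 1 by lra.
rewrite lerBlDr (le_trans (expR_le_inv1B y1))//.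
by rewrite -[leLHS]mul1r ler_pdivrMr; [nra|lra].
Qed.

Lemma energy_ge a b (h : 'rV[R]_n -> R) : pinched a b h -> continuous h ->
  ln a * fine (lam S) <= energy lam mu p h.
Proof.
move=> hab hc; have [a0 hb] := hab.
rewrite /energy -[leLHS]addr0 lerD//.
  have := Rintegral_ge_indic lam_fin (c := ln a) (k := 0) (A := set0)
    (integrable_ln lam_fin hab hc) measurable0.
  rewrite mul0r addr0; apply => z zS; rewrite mul0r addr0.
  rewrite ler_ln ?posrE ?(pinched_gt0 hab)//.
  by have /andP[] := hb _ zS.
rewrite mulr_ge0 ?invr_ge0 ?(ltW p0)//.
by apply: Rintegral_ge0 => z _; exact: powR_ge0.
Qed.

(** A limit of conjugates can be put back among the conjugates at no cost: the biconjugate lowers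
    the logarithmic term and has the same conjugate on the sphere. *)
Lemma energy_conjf2_le a b (h : 'rV[R]_n -> R) : pinched a b h -> continuous h ->
  energy lam mu p (conjf (conjf h)) <= energy lam mu p h.
Proof.
move=> hab hc; have mS := @usphere_measurable R n.
have [S0|/set0P/negP/negPn/eqP S0] := pselect (S !=set0); last first.
  by rewrite /energy S0 !Rintegral_set0.
have gab := pinched_conjf hab S0; have hab2 := pinched_conjf gab S0.
rewrite /energy; apply: lerD.
  apply: le_Rintegral.
  - exact: mS.
  - by apply: (integrable_ln lam_fin hab2); exact: conjf_continuous gab.
  - exact: (integrable_ln lam_fin hab).
  move=> x xS; rewrite ler_ln ?posrE ?(pinched_gt0 hab)// ?(pinched_gt0 hab2)//.
  exact: conjf_conjf_le hab xS.
have -> : \int[mu]_(u in S) conjf (conjf (conjf h)) u `^ p =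
    \int[mu]_(u in S) conjf h u `^ p.
  by apply: eq_Rintegral => u; rewrite inE => uS; rewrite (conjf3 hab).
exact: lexx.
Qed.

Lemma energy_minimizer : exists2 h : 'rV[R]_n -> R, is_conjf h &
  forall h', is_conjf h' -> energy lam mu p h <= energy lam mu p h'.
Proof.
pose E := [set energy lam mu p h | h in is_conjf].
pose h1 : 'rV[R]_n -> R := conjf (fun=> 1).
have ch1 : is_conjf h1.
  by exists 1, 1, (fun=> 1); split => //; split => // u _; rewrite lexx.
(* The slack 1 puts every member of the minimizing sequence, whose excess is below [k.+1%:R^-1], in
   the sublevel of [J], where the bounds [a], [b] are uniform. *)
pose J := energy lam mu p h1 + 1.
have [a [b [a0 HJ]]] := energy_coercive p0 lam_fin mu_fin lam_pos mu_pos J.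
have pinJ h : is_conjf h -> energy lam mu p h <= J -> pinched a b h.
  move=> ch hJ; have [a' [b' hab]] := is_conjf_pinched ch.
  apply: (HJ _ _ _ hab) => //; first exact: is_conjf_continuous.
  by move=> x xS; exact: is_conjf_conjf2.
have E1 : E (energy lam mu p h1) by exists h1.
have infE : has_inf E.
  split; first by exists (energy lam mu p h1).
  exists (Num.min (ln a * fine (lam S)) J) => _ [h ch <-].
  rewrite ge_min; have [hJ|/ltW Jh] := leP (energy lam mu p h) J.
    by rewrite (energy_ge (pinJ _ ch hJ) (is_conjf_continuous ch)).
  by rewrite Jh orbT.
have /choice[h_ Hh_] : forall k : nat, exists h : 'rV[R]_n -> R,
    is_conjf h /\ energy lam mu p h < inf E + k.+1%:R^-1.
  move=> k; have k0 : 0 < k.+1%:R^-1 :> R by rewrite invr_gt0.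
  by have [_ [h ch <-] hE] := inf_adherent k0 infE; exists h.
have infJ : inf E <= energy lam mu p h1 by apply: ge_inf => //; case: infE.
have pinh k : pinched a b (h_ k).
  have [ck hk] := Hh_ k; apply: pinJ => //.
  rewrite (le_trans (ltW hk))// lerD// invf_le1//.
  by rewrite ler1n.
have [S0|S0] := pselect (S !=set0); last first.
  exists h1; first by [].
  move=> h' _; have -> : energy lam mu p h1 = energy lam mu p h'.
    by apply: eq_energy => x xS; exfalso; apply: S0; exists x.
  exact: lexx.
(* [H k] agrees with [h_ k] on the sphere, but its Lipschitz constant comes from the uniform bounds
   [a], [b] instead of the unknown function of which [h_ k] is the conjugate. *)
pose g_ k := conjf (h_ k); pose H k := conjf (g_ k).
have ping k : pinched b^-1 a^-1 (g_ k) by exact: pinched_conjf.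
have EH k x : S x -> H k x = h_ k x.
  by move=> xS; apply: is_conjf_conjf2 => //; have [] := Hh_ k.
have pinH k : pinched a b (H k).
  by split=> // x xS; rewrite EH//; have [_ ->] := pinh k.
have b0 : 0 < b by case: S0 => x xS; exact: pinched_ub_gt0 (pinh 0%N) xS.
pose L := n%:R / b^-1.
have L0 : 0 <= L by rewrite /L invrK mulr_ge0// ltW.
have HL k x y : `|H k x - H k y| <= L * `|x - y| by exact: conjf_lipschitz (ping k).
have [h [hL hclose]] := equilipschitz_cluster L0 HL (fun k => conjf0 (g_ k)).
have hc : continuous h := lipschitz_continuous hL.
have hab : pinched a b h.
  split => // x xS; apply/andP; split; apply/ler_addgt0Pr => e e0;
    have [k _ /(_ _ xS)] := hclose e 0%N e0; rewrite ltr_norml => /andP[? ?];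
    have [_ /(_ _ xS) /andP[? ?]] := pinH k; lra.
suff hinf : energy lam mu p h <= inf E.
  exists (conjf (conjf h)).
    by exists b^-1, a^-1, (conjf h); split => //; exact: pinched_conjf.
  move=> h' ch'; apply: (le_trans (energy_conjf2_le hab hc)).
  by apply: (le_trans hinf); apply: ge_inf; [case: infE|exists h'].
set Lm := fine (lam S); set B := p^-1 * (2 * p * (a^-1 `^ p * fine (mu S))).
have Lm0 : 0 <= Lm by rewrite fine_ge0.
have B0 : 0 <= B.
  by rewrite !mulr_ge0 ?invr_ge0 ?(ltW p0) ?powR_ge0 ?fine_ge0.
have main eta : 0 < eta -> p * eta <= 2^-1 ->
    energy lam mu p h <= inf E + eta * (1 + Lm + B).
  move=> eta0 peta; have ae0 : 0 < a * eta by rewrite mulr_gt0.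
  (* The tolerance [a * eta] becomes the factor [expR eta >= 1 + eta], as both functions are at
     least [a]; the index bound makes the excess energy at most [eta]. *)
  have [k Nk kS] := hclose (a * eta) (Num.bound eta^-1) ae0.
  have kc : continuous (H k) := lipschitz_continuous (HL k).
  have e1 := expR_ge1Dx eta.
  have close u v : a <= u -> `|v - u| < a * eta -> v <= expR eta * u.
    move=> au; rewrite ltr_norml => /andP[_ vu].
    have : (1 + eta) * u <= expR eta * u by rewrite ler_wpM2r// (le_trans (ltW a0)).
    have : a * eta <= eta * u by rewrite mulrC ler_wpM2l// ltW.
    rewrite mulrDl mul1r; lra.
  have := @energy_continuity _ _ lam mu p p0 lam_fin mu_fin _ _ h (H k) eta
    hab (pinH k) hc kc eta0.
  move=> /(_ _ _)/le_trans; apply.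
  - move=> x xS; apply: close; last by rewrite distrC kS.
    by have [_ /(_ _ xS)/andP[]] := pinH k.
  - move=> x xS; apply: close; last exact: kS.
    by have [_ /(_ _ xS)/andP[]] := hab.
  have hk : energy lam mu p (H k) <= inf E + eta.
    rewrite (eq_energy lam mu p (EH k)).
    have [_ /ltW hk] := Hh_ k; rewrite (le_trans hk)// lerD2l.
    rewrite -[leRHS]invrK lef_pV2 ?posrE ?invr_gt0//.
    have := archi_boundP (ltW (_ : 0 < eta^-1)); rewrite invr_gt0 => /(_ eta0).
    by move=> /ltW/le_trans; apply; rewrite ler_nat (leq_trans Nk).
  have ep : expR (p * eta) - 1 <= 2 * p * eta.
    by rewrite -mulrA expR_sub1_le// mulr_ge0 ?ltW.
  rewrite !mulrDr mulr1 !addrA; apply: lerD.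
    by apply: lerD; [exact: hk|exact: lexx].
  rewrite /B [leRHS]mulrCA ler_wpM2l ?invr_ge0 ?(ltW p0)//.
  rewrite [leRHS]mulrA ler_wpM2r ?mulr_ge0 ?powR_ge0 ?fine_ge0//.
  by rewrite [leRHS]mulrC.
apply/ler_addgt0Pr => e e0.
set D := 1 + Lm + B; have D0 : 0 < D by rewrite /D -addrA ltr_wpDr// addr_ge0.
pose eta := Num.min (e / D) (p^-1 / 2).
have eta0 : 0 < eta by rewrite lt_min !divr_gt0 ?invr_gt0.
have := main eta eta0; move=> /(_ _)/le_trans; apply.
  rewrite mulrC -ler_pdivlMr// mulrC ge_min.
  by rewrite lexx orbT.
by rewrite lerD2l -ler_pdivlMr// ge_min lexx.
Qed.

End MinimizerExistence.

(** * First variation *)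

Section Variation.
Context {R : realType} {n : nat}.
Variables (lam mu : {measure set (Borel R n) -> \bar R}) (p : R).
Hypothesis p0 : 0 < p.
Hypotheses (lam_fin : (lam setT < +oo)%E) (mu_fin : (mu setT < +oo)%E).
Local Notation S := (usphere R n).
Variable h : 'rV[R]_n -> R.
Hypothesis hconj : is_conjf h.
Hypothesis hmin : forall h', is_conjf h' -> energy lam mu p h <= energy lam mu p h'.
Local Notation g := (conjf h).

(** The competitor is [conjf f], whose conjugate is at most [f]. Hence [f] itself may stand in the
    second integral, and it may be discontinuous. *)
Lemma minimizer_le a b f : pinched a b f ->
  measurable_fun setT (f : Borel R n -> R) ->
  energy lam mu p h <= \int[lam]_(x in S) ln (conjf f x)
    + p^-1 * \int[mu]_(u in S) f u `^ p.
Proof.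
move=> fab mf; have mS := @usphere_measurable R n.
have cf : is_conjf (conjf f) by exists a, b, f.
apply: (le_trans (hmin cf)); rewrite /energy; apply: lerD; first exact: lexx.
rewrite ler_wpM2l ?invr_ge0 ?(ltW p0)//.
have [S0|/set0P/negP/negPn/eqP S0] := pselect (S !=set0); last first.
  by rewrite S0 !Rintegral_set0.
have gab := pinched_conjf fab S0; have gab2 := pinched_conjf gab S0.
apply: le_Rintegral; first exact: mS.
- apply: (integrable_powR mu_fin p0 gab2).
  by apply: continuous_measurable_Borel; exact: conjf_continuous gab.
- exact: (integrable_powR mu_fin p0 fab).
move=> u uS; rewrite ge0_ler_powR ?nnegrE ?(ltW p0)//.
- exact: ltW (pinched_gt0 gab2 uS).
- exact: ltW (pinched_gt0 fab uS).
- exact: conjf_conjf_le fab uS.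
Qed.

Local Notation mass A := (\int[mu]_(u in S `&` A) g u `^ p).

(** The competitor is [expR (- t) * g]: the first term rises by at most [t * lam(S)], the second is
    multiplied by [expR (- (p * t))]. *)
Lemma minimizer_mass_le : mass setT <= fine (lam S).
Proof.
have mS := @usphere_measurable R n; rewrite setIT.
have [S0|/set0P/negP/negPn/eqP S0] := pselect (S !=set0); last first.
  by rewrite S0 Rintegral_set0 measure0.
have [a [b hab]] := is_conjf_pinched hconj.
have hc := is_conjf_continuous hconj.
have gab := pinched_conjf hab S0; have gc := conjf_continuous hab.
have gi := integrable_powR mu_fin p0 gab (continuous_measurable_Borel gc).
have li := integrable_ln lam_fin hab hc.
set I := \int[mu]_(u in S) g u `^ p; set L := fine (lam S).
have L0 : 0 <= L by rewrite fine_ge0.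
have main t : 0 < t -> I <= L + L * (p * t).
  move=> t0; pose f u := expR (- t) * g u.
  have et0 : 0 < expR (- t) by exact: expR_gt0.
  have fab : pinched (expR (- t) * b^-1) (expR (- t) * a^-1) f.
    have [b0 gb] := gab; split; first by rewrite mulr_gt0.
    by move=> u uS; have /andP[g1 g2] := gb _ uS; rewrite /f !ler_wpM2l ?(ltW et0).
  have mf : measurable_fun setT (f : Borel R n -> R).
    by apply: measurable_funM => //; exact: continuous_measurable_Borel.
  have cf0 := pinched_gt0 (pinched_conjf fab S0).
  have h1 : \int[lam]_(x in S) ln (conjf f x) <= \int[lam]_(x in S) ln (h x) + t * L.
    have ic : lam.-integrable S (EFin \o (fun=> t)).
      by apply: (bounded_integrable_usphere (M := `|t|)).
    rewrite -(Rintegral_cst lam mS) -RintegralD//; apply: le_Rintegral.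
    - exact: mS.
    - by apply: (integrable_ln lam_fin (pinched_conjf fab S0)); exact: conjf_continuous fab.
    - by have := integrableD mS li ic; apply: eq_integrable.
    move=> x xS; have h0 := pinched_gt0 hab xS.
    rewrite -[t]expRK -lnM ?posrE ?expR_gt0// ler_ln ?posrE ?cf0//; last first.
      by rewrite mulr_gt0// expR_gt0.
    rewrite mulrC -(is_conjf_conjf2 hconj xS).
    apply: (conjf_anti gab) => // [u uS||u uS].
    - exact: pinched_gt0 fab uS.
    - exact: expR_gt0.
    - by rewrite /f mulrA -expRD subrr expR0 mul1r.
  have h2 : \int[mu]_(u in S) f u `^ p = expR (- (p * t)) * I.
    rewrite -RintegralZl//; apply: eq_Rintegral => u; rewrite inE => uS.
    rewrite /f powRM ?(ltW et0)//; last exact: ltW (pinched_gt0 gab uS).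
    by rewrite -expRM mulNr [t * p]mulrC.
  have := minimizer_le fab mf; rewrite h2 /energy -/I.
  move=> /le_trans /(_ (lerD h1 (lexx _))).
  move: (\int[lam]_(x in S) ln (h x)) => A.
  rewrite -addrA lerD2l.
  have I0 : 0 <= I by apply: Rintegral_ge0 => u _; exact: powR_ge0.
  have pt0 : 0 < p * t by rewrite mulr_gt0.
  (* With this bound the comparison is rational in [t] and the factor [p * t] cancels, leaving
     [I <= L + L * (p * t)]. *)
  have e1 : expR (- (p * t)) <= (1 + p * t)^-1.
    by rewrite expRN lef_pV2 ?posrE ?expR_gt0 ?addr_gt0// expR_ge1Dx.
  have e2 : expR (- (p * t)) * I <= (1 + p * t)^-1 * I by rewrite ler_wpM2r.
  move: (expR _ * I) e2 => Z e2 Zh.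
  have q0 : 0 < 1 + p * t by rewrite addr_gt0.
  have e3 : p^-1 * Z <= p^-1 * ((1 + p * t)^-1 * I).
    by rewrite ler_wpM2l// invr_ge0 ltW.
  have : p^-1 * I <= t * L + p^-1 * ((1 + p * t)^-1 * I).
    by apply: (le_trans Zh); rewrite lerD2l.
  rewrite -(ler_pM2l p0) mulrDr !mulrA divff ?gt_eqF// !mul1r.
  rewrite -(ler_pM2l q0) mulrDr !mulrA divff ?gt_eqF// !mul1r.
  rewrite mulrDl mul1r addrC lerD2r => e4.
  move: e4; clear -pt0 p0 t0 L0; move: (I) => J.
  rewrite -mulrA => e4.
  have : (p * t) * J <= (p * t) * (L + L * (p * t)).
    by rewrite (le_trans e4)//; nra.
  by rewrite ler_pM2l// mulrA.
apply/ler_addgt0Pr => e e0.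
have D0 : 0 < L * p + 1 by rewrite ltr_wpDl// mulr_ge0// ltW.
apply: (le_trans (main (e / (L * p + 1)) _)); first by rewrite divr_gt0.
rewrite lerD2l mulrA mulrA ler_pdivrMr// mulrC ler_wpM2l ?(ltW e0)//.
by rewrite lerDl.
Qed.

(** [E] consists of normals whose Young gap outside [O] is at least [d]. The margin is what allows
    one [t] for all [x] in [E]; it is removed later by exhaustion. *)
Lemma minimizer_open_le (O E : set 'rV[R]_n) (d : R) :
  measurable (O : set (Borel R n)) -> measurable (E : set (Borel R n)) ->
  E `<=` S -> 0 < d ->
  (forall x u, E x -> S u -> ~ O u -> dotp u x + d <= g u * h x) ->
  fine (lam E) <= mass O.
Proof.
move=> mO mE ES d0 HE; have mS := @usphere_measurable R n.
have [S0|/set0P/negP/negPn/eqP S0] := pselect (S !=set0); last first.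
  rewrite (_ : E = set0); last by rewrite -subset0 -S0.
  by rewrite measure0 S0 set0I Rintegral_set0.
have [a [b hab]] := is_conjf_pinched hconj.
have hc := is_conjf_continuous hconj.
have gab := pinched_conjf hab S0; have gc := conjf_continuous hab.
have gi := integrable_powR mu_fin p0 gab (continuous_measurable_Borel gc).
have li := integrable_ln lam_fin hab hc.
have [a0 _] := hab.
have b0 : 0 < b by case: S0 => x xS; exact: pinched_ub_gt0 hab xS.
have mSO : measurable (S `&` O : set (Borel R n)) by exact: measurableI.
have giO : mu.-integrable S (EFin \o ((fun u => g u `^ p) \_ O)).
  rewrite -restrict_EFin; apply/integrable_restrict => //.
  by apply: integrableS gi.
set I := mass O; set L := fine (lam E).
have I0 : 0 <= I by apply: Rintegral_ge0 => u _; exact: powR_ge0.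
have L0 : 0 <= L by rewrite fine_ge0.
(* [B] bounds [g u * h x] on the sphere. If [t * B <= d], then [expR (- t) * (g u * h x) >= g u * h
   x - d], so the margin pays for the factor [expR (- t)] at directions outside [O]. *)
set B := a^-1 * b; have B0 : 0 < B by rewrite mulr_gt0// invr_gt0.
have main t : 0 < t -> t * B <= d -> p * t < 1 -> L <= I + L * (p * t).
  move=> t0 td pt1; pose f u := expR (t * \1_O u) * g u.
  have f1 u : O u -> f u = expR t * g u.
    by move=> Ou; rewrite /f indicE mem_set// mulr1.
  have f2 u : ~ O u -> f u = g u.
    by move=> Ou; rewrite /f indicE memNset// mulr0 expR0 mul1r.
  have et1 : 1 <= expR t by rewrite -expR0 ler_expR ltW.
  have fab : pinched b^-1 (expR t * a^-1) f.
    have [bi0 gb] := gab; split => // u uS.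
    have /andP[g1 g2] := gb _ uS; have g0 := pinched_gt0 gab uS.
    have [Ou|Ou] := pselect (O u); rewrite ?(f1 u Ou) ?(f2 u Ou).
      by rewrite ler_wpM2l ?expR_ge0// andbT (le_trans g1)// ler_peMl// ltW.
    by rewrite g1/= (le_trans g2)// ler_peMl// invr_ge0 ltW.
  have mf : measurable_fun setT (f : Borel R n -> R).
    apply: measurable_funM; last exact: continuous_measurable_Borel.
    apply: (measurableT_comp (@measurable_expR R)).
    by apply: measurable_funM.
  have cf0 := pinched_gt0 (pinched_conjf fab S0).
  have h1 : \int[lam]_(x in S) ln (conjf f x) <= \int[lam]_(x in S) ln (h x) + - t * L.
    have mIE := integrable_cst_indic lam_fin 0 (- t) mE.
    have <- : \int[lam]_(x in S) (0 + - t * \1_E x) = - t * L.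
      rewrite Rintegral_cst_indic// mul0r add0r (_ : S `&` E = E)//.
      by apply/setIidPr.
    rewrite -RintegralD//; apply: le_Rintegral.
    - exact: mS.
    - by apply: (integrable_ln lam_fin (pinched_conjf fab S0)); exact: conjf_continuous fab.
    - by have := integrableD mS li mIE; apply: eq_integrable.
    move=> x xS; have h0 := pinched_gt0 hab xS; rewrite add0r.
    have key c : 0 < c -> (forall u, S u -> dotp u x <= c * f u) ->
        ln (conjf f x) <= ln c.
      move=> c0 Hc; rewrite ler_ln ?posrE ?cf0//.
      apply: conjf_le => // u uS.
      by rewrite ler_pdivrMr ?(pinched_gt0 fab uS)// Hc.
    have gh u : S u -> dotp u x <= g u * h x.
      by move=> uS; rewrite -(is_conjf_conjf2 hconj xS); exact: conjf_young gab uS.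
    rewrite indicE; have [xE|xE] := boolP (x \in E); last first.
      rewrite mulr0 addr0; apply: key => // u uS.
      rewrite (le_trans (gh _ uS))// mulrC ler_wpM2l ?(ltW h0)//.
      have [Ou|Ou] := pselect (O u); rewrite ?(f1 u Ou) ?(f2 u Ou)//.
      by rewrite ler_peMl// (ltW (pinched_gt0 gab uS)).
    rewrite mulr1 -[- t]expRK -lnM ?posrE ?expR_gt0//.
    apply: key; first by rewrite mulr_gt0// expR_gt0.
    move=> u uS; have g0 := pinched_gt0 gab uS.
    have [Ou|Ou] := pselect (O u); rewrite ?(f1 u Ou) ?(f2 u Ou).
      by rewrite -mulrA [expR (- t) * _]mulrA -expRD addNr expR0 mul1r mulrC gh.
    have xE' : E x by rewrite inE in xE.
    have dh := HE _ _ xE' uS Ou.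
    have ghB : g u * h x <= B.
      have [_ /(_ _ uS) /andP[_ g2]] := gab; have [_ /(_ _ xS) /andP[_ h2]] := hab.
      by rewrite ler_pM ?(ltW g0) ?(ltW h0).
    have e1 := expR_ge1Dx (- t).
    have gh0 : 0 < g u * h x by rewrite mulr_gt0.
    rewrite [_ * expR _]mulrC -mulrA [h x * _]mulrC.
    have : (1 - t) * (g u * h x) <= expR (- t) * (g u * h x).
      by rewrite ler_wpM2r// ltW.
    have : t * (g u * h x) <= t * B by rewrite ler_wpM2l// ltW.
    move: dh td; clear; move: (g u * h x) (expR (- t)) => X Y; lra.
  have h2 : \int[mu]_(u in S) f u `^ p =
      \int[mu]_(u in S) g u `^ p + (expR (p * t) - 1) * I.
    rewrite /I Rintegral_mkcondr -RintegralZl// -RintegralD//; last first.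
      by have := integrableZl mS (expR (p * t) - 1) giO; apply: eq_integrable.
    apply: eq_Rintegral => u; rewrite inE => uS; rewrite patchE.
    have g0 := ltW (pinched_gt0 gab uS).
    have [Ou|Ou] := pselect (O u).
      rewrite (f1 u Ou) mem_set// powRM ?expR_ge0// -expRM [t * p]mulrC.
      by rewrite mulrBl mul1r addrC subrK.
    by rewrite (f2 u Ou) memNset// mulr0 addr0.
  have := minimizer_le fab mf; rewrite h2 /energy.
  move=> /le_trans /(_ (lerD h1 (lexx _))).
  have pt0 : 0 < p * t by rewrite mulr_gt0.
  have e1 : expR (p * t) <= (1 - p * t)^-1 by exact: expR_le_inv1B.
  have e2 : (expR (p * t) - 1) * I <= ((1 - p * t)^-1 - 1) * I.
    by rewrite ler_wpM2r// lerD2r.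
  move: (\int[lam]_(x in S) ln (h x)) (\int[mu]_(u in S) g u `^ p) e2 => A C.
  move: ((expR (p * t) - 1) * I) => Z e2.
  rewrite mulrDr addrA => e3.
  have {e3} e3 : t * L <= p^-1 * Z by move: e3; clear; move: (p^-1) => q; lra.
  have q0 : 0 < 1 - p * t by rewrite subr_gt0.
  have : t * L <= p^-1 * (((1 - p * t)^-1 - 1) * I).
    by apply: (le_trans e3); rewrite ler_wpM2l// invr_ge0 ltW.
  rewrite -(ler_pM2l p0) !mulrA divff ?gt_eqF// mul1r.
  rewrite -(ler_pM2l q0) !mulrA mulrBr divff ?gt_eqF// mulr1 opprB addrCA subrr addr0.
  move: (I) (L) => J K e4.
  have : (p * t) * (K - K * (p * t)) <= (p * t) * J.
    by apply: le_trans e4; rewrite le_eqVlt; apply/orP; left; apply/eqP; ring.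
  by rewrite ler_pM2l// lerBlDr mulrA.
apply/ler_addgt0Pr => e e0.
have D0 : 0 < L * p + 1 by rewrite ltr_wpDl// mulr_ge0// ltW.
(* The three bounds keep the error below [e], [t * B] below [d], and [p * t] below 1, as
   [expR_le_inv1B] requires. *)
pose t := Num.min (e / (L * p + 1)) (Num.min (d / B) (p^-1 / 2)).
have t0 : 0 < t by rewrite !lt_min !divr_gt0 ?invr_gt0.
have t1 : t <= e / (L * p + 1) by rewrite ge_min lexx.
have t2 : t <= d / B by rewrite !ge_min lexx orbT.
have t3 : t <= p^-1 / 2 by rewrite !ge_min lexx !orbT.
have tB : t * B <= d by rewrite -ler_pdivlMr.
have pt : p * t < 1.
  rewrite mulrC -ltr_pdivlMr// (le_lt_trans t3)// div1r ltr_pdivrMr//.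
  by rewrite ltr_pMr ?invr_gt0// ltr1n.
apply: (le_trans (main t t0 tB pt)); rewrite lerD2l.
move: t1; rewrite ler_pdivlMr// => t1; apply: le_trans t1.
have -> : t * (L * p + 1) = L * (p * t) + t by ring.
by rewrite lerDl ltW.
Qed.

End Variation.

(* The unit normals [x] at which the body with support function [h] is touched
   in some direction of [C]; for [h] a conjugate this is the radial Gauss image. *)
Definition contact {R : realType} {n : nat} (h : 'rV[R]_n -> R)
    (C : set 'rV[R]_n) : set 'rV[R]_n :=
  [set x | usphere R n x /\ exists2 u, C u &
    usphere R n u /\ dotp u x = conjf h u * h x].

(** * Contact sets *)

Section Contact.
Context {R : realType} {n : nat}.
Implicit Types (C O : set 'rV[R]_n).
Local Notation S := (usphere R n).
Variable h : 'rV[R]_n -> R.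
Hypothesis hconj : is_conjf h.
Local Notation g := (conjf h).

Lemma is_conjf_conjf_continuous : continuous g.
Proof. by have [a [b hab]] := is_conjf_pinched hconj; exact: conjf_continuous hab. Qed.

Lemma young_gap_continuous :
  continuous (fun z : 'rV[R]_n * 'rV[R]_n => g z.2 * h z.1 - dotp z.2 z.1).
Proof.
move=> z; apply: cvgB.
  apply: cvgM.
    apply: (@continuous_comp _ _ _ snd g z); first exact: cvg_snd.
    exact: is_conjf_conjf_continuous.
  apply: (@continuous_comp _ _ _ fst h z); first exact: cvg_fst.
  exact: is_conjf_continuous.
rewrite (_ : (fun z => _) = (fun z : 'rV[R]_n * 'rV[R]_n => dotp z.1 z.2)).
  by rewrite dotpC; exact: dotp_continuous.
by apply/funext => w; rewrite dotpC.
Qed.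

(** A projection of the compact set of pairs that give equality in Young's inequality. *)
Lemma contact_closed C : closed C -> closed (contact h C).
Proof.
move=> cC; apply: compact_closed; first exact: norm_hausdorff.
pose Z := (S `*` (S `&` C)) `&`
  [set z : 'rV[R]_n * 'rV[R]_n | g z.2 * h z.1 - dotp z.2 z.1 = 0].
have -> : contact h C = fst @` Z.
  apply/seteqP; split => [x [xS [u Cu [uS ux]]]|_ [[x u] [[/= xS [uS Cu]] ux] <-]].
    by exists (x, u) => //; split => //=; rewrite ux subrr.
  split => //; exists u => //; split => //; apply/esym/eqP.
  by rewrite -subr_eq0; apply/eqP.
apply: continuous_compact; first by apply: continuous_subspaceT => z; exact: cvg_fst.
have cS := @usphere_compact R n.
have cSC : compact (S `&` C) by apply: compact_closedI.
apply: compact_closedI; first exact: compact_setX.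
apply: (@preimage_closed _ _ (fun z : 'rV[R]_n * 'rV[R]_n => _) [set 0]).
  by move=> z _; exact: young_gap_continuous.
exact: (@accessible_closed_set1 R (hausdorff_accessible (@Rhausdorff R))).
Qed.

Lemma contact_measurable C : closed C -> measurable (contact h C : set (Borel R n)).
Proof. by move=> cC; apply: closed_measurable_Borel; exact: contact_closed. Qed.

Lemma young x u : S x -> S u -> dotp u x <= g u * h x.
Proof.
move=> xS uS; have [a [b hab]] := is_conjf_pinched hconj.
have S0 : S !=set0 by exists x.
by rewrite -(is_conjf_conjf2 hconj xS); exact: conjf_young (pinched_conjf hab S0) uS.
Qed.

Lemma young_gap_continuousl x : continuous (fun u : 'rV[R]_n => g u * h x - dotp u x).
Proof.
move=> u; apply: (@continuous_comp _ _ _ (fun u : 'rV[R]_n => (x, u))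
  (fun z : 'rV[R]_n * 'rV[R]_n => g z.2 * h z.1 - dotp z.2 z.1) u).
  apply: (@cvg_pair _ _ _ (nbhs u) (nbhs x) (nbhs u) _ _ _ (cst x) id).
    exact: cvg_cst.
  exact: cvg_id.
exact: young_gap_continuous.
Qed.

Lemma young_gap_continuousr u (d : R) :
  continuous (fun x : 'rV[R]_n => g u * h x - dotp u x - d).
Proof.
move=> x; apply: (@continuous_comp _ _ _ (fun x : 'rV[R]_n => (x, u))
  (fun z : 'rV[R]_n * 'rV[R]_n => g z.2 * h z.1 - dotp z.2 z.1 - d) x).
  apply: (@cvg_pair _ _ _ (nbhs x) (nbhs x) (nbhs u) _ _ _ id (cst u)).
    exact: cvg_id.
  exact: cvg_cst.
apply: (@continuous_comp _ _ _
  (fun z : 'rV[R]_n * 'rV[R]_n => g z.2 * h z.1 - dotp z.2 z.1)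
  (fun t : R => t - d)); first exact: young_gap_continuous.
by apply: cvgB; [exact: cvg_id|exact: cvg_cst].
Qed.

(** Compactness makes the strict Young inequality uniform; the gap has the form [k.+1%:R^-1] so that
    the exhaustion by margins is countable. *)
Lemma young_gap_compact C x : closed C -> S x -> ~ contact h C x ->
  exists k : nat, forall u, S u -> C u -> 0 <= g u * h x - dotp u x - k.+1%:R^-1.
Proof.
move=> cC xS nx.
have cSC : compact (S `&` C) by apply: compact_closedI => //; exact: usphere_compact.
have /compact_near_coveringP /(_ nat \oo
  (fun k u => 0 <= g u * h x - dotp u x - k.+1%:R^-1) _) := cSC.
case.
  move=> u [uS Cu]; have q0 : 0 < g u * h x - dotp u x.
    rewrite subr_gt0 lt_neqAle young// andbT; apply/eqP => ux.
    by apply: nx; split => //; exists u.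
  have q20 : 0 < (g u * h x - dotp u x) / 2 by rewrite divr_gt0.
  near=> u' k => /=.
  have dk : k.+1%:R^-1 < (g u * h x - dotp u x) / 2.
    by near: k; exact: (near_infty_natSinv_lt (PosNum q20)).
  have : `|(g u * h x - dotp u x) - (g u' * h x - dotp u' x)| <
      (g u * h x - dotp u x) / 2.
    near: u'.
    apply: (@cvgr_dist_lt _ _ _ (nbhs (u : 'rV[R]_n)) _
      (fun v : 'rV[R]_n => g v * h x - dotp v x)) => //.
    exact: young_gap_continuousl.
  rewrite ltr_norml => /andP[_]; move: dk; clear.
  move: (g u * h x - dotp u x) (g u' * h x - dotp u' x) (k.+1%:R^-1) => X Y Z; lra.
move=> N _ HN; exists N => u uS Cu.
by apply: (HN N) => /=.
Unshelve. all: by end_near. Qed.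

(** The supremum giving [h x] as a conjugate of [g] is attained: a uniform gap [d] would improve it
    to [h x - d * a], because [g <= a^-1]. *)
Lemma contact_setT x : S x -> contact h setT x.
Proof.
move=> xS; have [a [b hab]] := is_conjf_pinched hconj.
have S0 : S !=set0 by exists x.
have gab := pinched_conjf hab S0; have [a0 _] := hab.
apply: contrapT => nx; have [k Hk] := young_gap_compact closedT xS nx.
set d : R := k.+1%:R^-1 in Hk; have d0 : 0 < d by rewrite invr_gt0.
have : h x <= h x - d * a; last first.
  by rewrite leNgt gtrDl oppr_lt0 mulr_gt0.
rewrite -{1}(is_conjf_conjf2 hconj xS); apply: conjf_le => // u uS.
have g0 := pinched_gt0 gab uS; rewrite ler_pdivrMr// mulrBl.
have := Hk u uS I; rewrite subr_ge0 lerBrDr -lerBrDl [h x * _]mulrC => /le_trans; apply.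
rewrite lerD2l lerN2 -mulrA ler_piMr ?(ltW d0)//.
have [_ /(_ _ uS) /andP[_ ga]] := gab.
by rewrite mulrC -ler_pdivlMr// div1r.
Qed.

End Contact.

Section ContactMeasure.
Context {R : realType} {n : nat}.
Variables (lam mu : {measure set (Borel R n) -> \bar R}) (p : R).
Hypothesis p0 : 0 < p.
Hypotheses (lam_fin : (lam setT < +oo)%E) (mu_fin : (mu setT < +oo)%E).
Local Notation S := (usphere R n).
Variable h : 'rV[R]_n -> R.
Hypothesis hconj : is_conjf h.
Hypothesis hmin : forall h', is_conjf h' -> energy lam mu p h <= energy lam mu p h'.
Local Notation g := (conjf h).

(** The sets [E] to which the first variation applies; as [d] tends to 0 they increase to the
    normals that touch in [O] only. *)
Let margin (O : set 'rV[R]_n) (d : R) : set 'rV[R]_n :=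
  S `&` \bigcap_(u in S `&` ~` O) [set x | 0 <= g u * h x - dotp u x - d].

Let margin_closed O d : closed (margin O d).
Proof.
apply: closedI; first exact: usphere_closed.
apply: closed_bigI => u _.
rewrite (_ : [set x | _] = (fun x => g u * h x - dotp u x - d) @^-1` [set y | 0 <= y])//.
apply: preimage_closed; last exact: closed_ge.
by move=> x _; exact: young_gap_continuousr.
Qed.

Lemma complement_contact_le (O : set 'rV[R]_n) : open O ->
  fine (lam (S `\` contact h (~` O)))
  <= \int[mu]_(u in S `&` O) g u `^ p.
Proof.
move=> oO; pose d k : R := k.+1%:R^-1.
have d0 k : 0 < d k by rewrite invr_gt0.
have mM k : measurable (margin O (d k) : set (Borel R n)).
  by apply: closed_measurable_Borel; exact: margin_closed.
have cO : closed (~` O) by exact: open_closedC.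
have E : S `\` contact h (~` O) = \bigcup_k margin O (d k).
  apply/seteqP; split => [x [xS nx]|x [k _ [xS Mx]]]; last first.
    split => // -[_ [u nOu [uS ux]]].
    have := Mx u (conj uS nOu); rewrite /= ux subrr sub0r oppr_ge0.
    by rewrite leNgt d0.
  have [k Hk] := young_gap_compact hconj cO xS nx.
  by exists k => //; split => // u [uS uO]; exact: Hk.
rewrite E.
have cvgM : lam (margin O (d k)) @[k --> \oo] --> lam (\bigcup_k margin O (d k)).
  apply: nondecreasing_cvg_mu => //; first exact: bigcupT_measurable.
  move=> k l kl; apply/subsetPset => x [xS Mx]; split => // u uO.
  have := Mx u uO => /=; rewrite !subr_ge0; apply: le_trans.
  by rewrite lef_pV2 ?posrE// ler_nat.
rewrite -lee_fin fineK ?finite_Borel_fin_num//; last exact: bigcupT_measurable.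
have -> : lam (\bigcup_k margin O (d k)) = limn (fun k => lam (margin O (d k))).
  by apply/esym/cvg_lim.
apply: lime_le; first by apply/cvg_ex; eexists; exact: cvgM.
near=> k.
rewrite -[leLHS]fineK ?finite_Borel_fin_num// lee_fin.
apply: (minimizer_open_le p0 lam_fin mu_fin hconj hmin _ _ _ (d0 k)) => //.
- exact: open_measurable_Borel.
- by move=> x [].
move=> x u [xS Mx] uS nOu; have := Mx u (conj uS nOu) => /=.
by rewrite subr_ge0 lerBrDr addrC.
Unshelve. all: by end_near. Qed.

End ContactMeasure.

(** * Almost everywhere uniqueness of the contact point *)

Section LipschitzGraph.
Context {R : realType}.

Lemma grid_cell (m : nat) (s : R) : (0 < m)%N -> 0 <= s <= m%:R ->
  exists k : 'I_m, k%:R <= s <= k.+1%:R.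
Proof.
case: m => // m _; elim: m => [|m IH] /andP[s0 sm].
  by exists ord0; rewrite s0.
have [s1|s1] := leP s m.+1%:R.
  have [|k kP] := IH; first by rewrite s0.
  by exists (widen_ord (leqnSn _) k).
by exists ord_max; rewrite sm (ltW s1).
Qed.

(* Cover each column of a grid of mesh [2/m] by one box of height [O(1/m)]. *)
Lemma leb_outer_Lipschitz_graph (n : nat) (N : set 'rV[R]_n.+1) (i : 'I_n.+1) (C : R) :
  0 <= C -> (forall x j, N x -> `|x 0 j| <= 1) ->
  (forall x y, N x -> N y -> `|x 0 i - y 0 i| <=
     C * \sum_(j < n) `|x 0 (lift i j) - y 0 (lift i j)|) ->
  leb_outer R n.+1 N = 0%E.
Proof.
move=> C0 N1 NL; apply/eqP; rewrite eq_le; apply/andP; split; last first.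
  apply: le_ereal_inf_tmp => _ [ab [abP _] <-]; apply: nneseries_ge0 => k _ _.
  by rewrite lee_fin; apply: prodr_ge0 => j _; rewrite subr_ge0.
apply/lee_addgt0Pr => e e0; rewrite add0e.
(* [V / m] is the total volume: [m^n] columns with base [(2 / m)^n] and height [2 * D], where
   [D = C * n * (2 / m)]. *)
pose V : R := 2 ^+ n * (4 * (C * n%:R)).
have V0 : 0 <= V by rewrite mulr_ge0 ?exprn_ge0// !mulr_ge0.
have [m m0 mV] : exists2 m : nat, (0 < m)%N & V / m%:R <= e.
  exists (Num.bound (V / e)).+1 => //.
  rewrite ler_pdivrMr// mulrC -ler_pdivrMr//.
  by rewrite (le_trans (ltW (archi_boundP _)))// ?ler_nat// divr_ge0// ltW.
have mR : 0 < m%:R :> R by rewrite ltr0n.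
pose lo (k : {ffun 'I_n -> 'I_m}) (j : 'I_n) : R := - 1 + 2 * (k j)%:R / m%:R.
pose up (k : {ffun 'I_n -> 'I_m}) (j : 'I_n) : R := - 1 + 2 * (k j).+1%:R / m%:R.
have up_lo k j : up k j - lo k j = 2 / m%:R by rewrite /up /lo -(natr1 (k j)); ring.
pose D : R := C * (n%:R * (2 / m%:R)).
have D0 : 0 <= D by rewrite mulr_ge0// mulr_ge0// divr_ge0// ltW.
pose column k (x : 'rV[R]_n.+1) := forall j, lo k j <= x 0 (lift i j) <= up k j.
have /choice[c Hc] : forall k, exists c : R, forall x, N x -> column k x -> `|x 0 i - c| <= D.
  move=> k; have [[y [Ny ky]]|nex] := pselect (exists y, N y /\ column k y); last first.
    by exists 0 => x Nx kx; exfalso; apply: nex; exists x.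
  exists (y 0 i) => x Nx kx; rewrite (le_trans (NL _ _ Nx Ny))// /D ler_wpM2l//.
  rewrite (@le_trans _ _ (\sum_(j < n) 2 / m%:R))//.
    apply: ler_sum => j _; have /andP[x1 x2] := kx j; have /andP[y1 y2] := ky j.
    have := up_lo k j; rewrite ler_norml; move: x1 x2 y1 y2; move: (lo k j) (up k j) => A B.
    by move=> *; apply/andP; split; lra.
  by rewrite sumr_const card_ord [leRHS]mulr_natl lexx.
pose bot k : 'rV[R]_n.+1 := \row_j if unlift i j is Some j' then lo k j' else c k - D.
pose top k : 'rV[R]_n.+1 := \row_j if unlift i j is Some j' then up k j' else c k + D.
pose T : finType := {ffun 'I_n -> 'I_m}.
(* Indices past the last column get the single point 0, a box of volume 0 as the product has at
   least one factor. *)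
pose pt (f : T -> 'rV[R]_n.+1) (k : nat) : 'rV[R]_n.+1 :=
  if insub k is Some k' then f (enum_val (k' : 'I_#|T|)) else 0.
have lo_up k j : lo k j <= up k j.
  by rewrite lerD2l ler_pM2r ?invr_gt0// ler_pM2l// ler_nat.
have bt k j : bot k 0 j <= top k 0 j.
  rewrite !mxE; case: (unlift i j) => [j'|]; first exact: lo_up.
  by rewrite lerD2l (le_trans _ D0)// oppr_le0.
have vol k : \prod_(j < n.+1) (top k 0 j - bot k 0 j) = (2 / m%:R) ^+ n * (2 * D).
  rewrite (bigD1_ord i)//= !mxE unlift_none mulrC.
  rewrite (eq_bigr (fun=> 2 / m%:R)) => [|j _]; last first.
    by rewrite !mxE liftK up_lo.
  by rewrite prodr_const card_ord; congr (_ * _); ring.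
apply: (@le_trans _ _ (V / m%:R)%:E); last by rewrite lee_fin.
apply: ereal_inf_lbound; exists (pt bot, pt top).
  split => [k j /=|x Nx].
    by rewrite /pt; case: insubP => [k' _ _|_]; [exact: bt|rewrite lexx].
  have /fin_all_exists[k Hk] : forall j : 'I_n, exists k : 'I_m,
      - 1 + 2 * k%:R / m%:R <= x 0 (lift i j) <= - 1 + 2 * k.+1%:R / m%:R.
    move=> j; have := N1 _ (lift i j) Nx; rewrite ler_norml => /andP[x1 x2].
    have [|k /andP[k1 k2]] := @grid_cell m ((x 0 (lift i j) + 1) / 2 * m%:R) m0.
      apply/andP; split; first by rewrite mulr_ge0 ?divr_ge0//; lra.
      by rewrite ler_piMl//; lra.
    exists k; apply/andP; split.
      rewrite addrC -lerBrDr ler_pdivrMr//; move: k1; lra.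
    by rewrite addrC -lerBlDr ler_pdivlMr//; move: k2; lra.
  pose K : T := finfun k.
  have xK : column K x by move=> j; rewrite /lo /up ffunE.
  exists (enum_rank K) => //=; rewrite /pt valK enum_rankK => j.
  rewrite !mxE; case: unliftP => [j' ->|->]; first exact: xK.
  by have := Hc K x Nx xK; rewrite ler_distl.
rewrite (nneseries_split 0 #|T|); last first.
  move=> k _; rewrite lee_fin; apply: prodr_ge0 => j _ /=.
  by rewrite subr_ge0 /pt; case: insubP => [k' _ _|_]; [exact: bt|rewrite lexx].
rewrite add0n eseries0 => [|k Tk _]; last first.
  have pt0 f : pt f k = 0 by rewrite /pt insubF// ltnNge Tk.
  by rewrite (bigD1_ord ord0)//= !pt0 subrr mul0r.
rewrite adde0 big_mkord sumEFin; congr EFin.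
rewrite (eq_bigr (fun=> (2 / m%:R) ^+ n * (2 * D))) => [|k _]; last first.
  rewrite -(vol (enum_val k)); apply: eq_bigr => j _ /=.
  by rewrite /pt valK.
rewrite sumr_const card_ord card_ffun !card_ord -[LHS]mulr_natl natrX mulrA -exprMn.
rewrite (_ : m%:R * (2 / m%:R) = 2); last by field; rewrite gt_eqF.
by rewrite /V /D -!mulrA; congr (_ * _); field; rewrite gt_eqF.
Qed.

End LipschitzGraph.

Section DoubleContact.
Context {R : realType}.

(* Monotonicity of the subdifferential of the support function: as the contact
   points differ by [r' - r] in the direction [e_i], the double contact set meets
   each line parallel to [e_i] at most once, in a Lipschitz way. *)
Lemma sph_outer_double_contact (n : nat) (h : 'rV[R]_n -> R) (i : 'I_n) (r r' : R) :
  is_conjf h -> r < r' ->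
  sph_outer R n (contact h [set u : 'rV[R]_n | r' * conjf h u <= u 0 i] `&`
                 contact h [set u : 'rV[R]_n | u 0 i <= r * conjf h u]) = 0%E.
Proof.
case: n h i => [h []//|n] h i hconj rr'; rewrite /sph_outer.
set w := _ `&` _; set g := conjf h.
suff -> : leb_outer R n.+1 (cone01 w) = 0%E by rewrite mule0.
have [[x0 [[x0S _] _]]|w0] := pselect (w !=set0); last first.
  by apply: (@leb_outer_Lipschitz_graph _ _ _ i 0) => // [x j|x y] [t [u [_ [wu _]]]];
    exfalso; apply: w0; exists u.
have [a [b hab]] := is_conjf_pinched hconj.
have S0 : usphere R n.+1 !=set0 by exists x0.
have gab := pinched_conjf hab S0; have [bi0 gb] := gab.
set A := b^-1 in bi0 gb.
have ri0 : 0 < r' - r by rewrite subr_gt0.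
apply: (@leb_outer_Lipschitz_graph _ _ _ i (2 * A^-1 / (r' - r))).
- by rewrite divr_ge0 ?(ltW ri0)// divr_ge0 ?(ltW bi0).
- move=> x j [t [u [/andP[t0 t1] [[[uS _] _] ->]]]].
  rewrite mxE normrM (gtr0_norm t0) mulr_ile1 ?(ltW t0)//.
  by rewrite (le_trans (le_coord_norm _ _))// usphere_norm_le1.
have bound u j : usphere R n.+1 u -> `|u 0 j / g u| <= A^-1.
  move=> uS; have /andP[gA _] := gb _ uS; have g0 := pinched_gt0 gab uS.
  rewrite normrM normfV (gtr0_norm g0) -[leRHS]mul1r ler_pM ?invr_ge0 ?(ltW g0)//.
    by rewrite (le_trans (le_coord_norm _ _))// usphere_norm_le1.
  by rewrite lef_pV2.
suff key x y : cone01 w x -> cone01 w y -> (y 0 i - x 0 i) * (r' - r) <=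
    2 * A^-1 * \sum_(j < n) `|x 0 (lift i j) - y 0 (lift i j)|.
  move=> x y wx wy; rewrite mulrAC ler_pdivlMr//.
  have h1 := key x y wx wy; have h2 := key y x wy wx.
  rewrite (eq_bigr (fun j => `|x 0 (lift i j) - y 0 (lift i j)|)) in h2; last first.
    by move=> j _; rewrite distrC.
  rewrite -[X in _ * X <= _](gtr0_norm ri0) -normrM ler_norml; apply/andP; split.
    by rewrite lerNl -mulNr opprB.
  exact: h2.
(* Contact points do not change when a normal is rescaled, so monotonicity applies to the points of
   the cone themselves. *)
move=> [t [x' [/andP[t0 _] [[[xS [u1 u1i [u1S u1x]]] _] ->]]]].
move=> [s [y' [/andP[s0 _] [[_ [yS [w2 w2i [w2S w2y]]]] ->]]]].
have g1 := pinched_gt0 gab u1S; have g2 := pinched_gt0 gab w2S.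
rewrite -/g in u1x w2y g1 g2.
(* The boundary points of the body with outer normals [X] and [Y]. Each maximizes its own linear
   form, whence [mono]; their [i]-th coordinates are separated by [r] and [r']. *)
pose v := (g u1)^-1 *: u1; pose z := (g w2)^-1 *: w2.
set X := t *: x'; set Y := s *: y'.
have vX : dotp v X = t * h x'.
  by rewrite dotpZl dotpZr u1x mulrCA mulKf// gt_eqF.
have zY : dotp z Y = s * h y'.
  by rewrite dotpZl dotpZr w2y mulrCA mulKf// gt_eqF.
have vY : dotp v Y <= s * h y'.
  rewrite dotpZl dotpZr mulrCA ler_wpM2l ?(ltW s0)// mulrC ler_pdivrMr// mulrC.
  exact: young.
have zX : dotp z X <= t * h x'.
  rewrite dotpZl dotpZr mulrCA ler_wpM2l ?(ltW t0)// mulrC ler_pdivrMr// mulrC.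
  exact: young.
have mono : dotp (v - z) (Y - X) <= 0.
  rewrite !(dotpBl, dotpBr) vX zY; move: vY zX; clear.
  move: (dotp v Y) (dotp z X) (t * h x') (s * h y') => *; lra.
rewrite dotpE (bigD1_ord i)//= in mono.
have vi : r' <= v 0 i by rewrite mxE mulrC ler_pdivlMr.
have zi : z 0 i <= r by rewrite mxE mulrC ler_pdivrMr.
have rest : - (2 * A^-1 * \sum_(j < n) `|X 0 (lift i j) - Y 0 (lift i j)|) <=
    \sum_(j < n) (v - z) 0 (lift i j) * (Y - X) 0 (lift i j).
  rewrite mulr_sumr -sumrN; apply: ler_sum => j _.
  rewrite lerNl (le_trans (ler_norm _))// normrN normrM.
  have vz : `|(v - z) 0 (lift i j)| <= 2 * A^-1.
    rewrite !mxE (le_trans (ler_normB _ _))//.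
    rewrite (_ : 2 * A^-1 = A^-1 + A^-1); last by ring.
    by rewrite lerD// mulrC bound.
  have YX k : (Y - X) 0 k = Y 0 k - X 0 k by rewrite !mxE.
  by rewrite ler_pM// YX distrC.
have [yx|xy] := leP (Y 0 i) (X 0 i).
  apply: (@le_trans _ _ 0).
    by rewrite mulr_le0_ge0 ?(ltW ri0)// subr_le0.
  by rewrite mulr_ge0 ?sumr_ge0// divr_ge0 ?(ltW bi0).
have h1 : (Y 0 i - X 0 i) * (r' - r) <= (v - z) 0 i * (Y - X) 0 i.
  have -> : (v - z) 0 i = v 0 i - z 0 i by rewrite !mxE.
  have -> : (Y - X) 0 i = Y 0 i - X 0 i by rewrite !mxE.
  by rewrite mulrC ler_wpM2r ?subr_ge0 ?(ltW xy)// lerB.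
move: h1 mono rest; clear.
move: ((Y 0 i - X 0 i) * (r' - r)) ((v - z) 0 i * (Y - X) 0 i) => *; lra.
Qed.

End DoubleContact.

Section Uniqueness.
Context {R : realType} {n : nat}.
Variable lam : {measure set (Borel R n) -> \bar R}.
Local Notation S := (usphere R n).
Hypothesis lam_ac : forall w : set (Borel R n), measurable w -> w `<=` S ->
     sph_outer R n w = 0%E -> lam w = 0%E.
Variable h : 'rV[R]_n -> R.
Hypothesis hconj : is_conjf h.
Local Notation g := (conjf h).

Lemma coord_gap_continuous (i : 'I_n) (r : R) :
  continuous (fun u : 'rV[R]_n => u 0 i - r * g u).
Proof.
move=> u; apply: (@cvgB _ _ _ (nbhs (u : 'rV[R]_n))).
  exact: coord_continuous.
apply: (@cvgM _ _ (nbhs (u : 'rV[R]_n))); first exact: cvg_cst.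
exact: is_conjf_conjf_continuous.
Qed.

(** Two contact points of one normal differ in some coordinate of [u / g u], and two rationals fit
    strictly between. The exceptional set is the countable union over such triples, enumerated by
    [unpickle]. *)
Lemma unique_contact : exists2 N : set 'rV[R]_n,
  measurable (N : set (Borel R n)) /\ lam N = 0%E &
  forall x u u', S x -> ~ N x -> S u -> S u' ->
    dotp u x = g u * h x -> dotp u' x = g u' * h x -> u = u'.
Proof.
pose N_ (irr : 'I_n * rat * rat) := let: (i, r, r') := irr in
  if (r < r')%R then contact h [set u : 'rV[R]_n | ratr r' * g u <= u 0 i] `&`
                 contact h [set u : 'rV[R]_n | u 0 i <= ratr r * g u] else set0.
pose F (k : nat) := if unpickle k is Some irr then N_ irr else set0.
have closed1 i r : closed [set u : 'rV[R]_n | r * g u <= u 0 i].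
  rewrite (_ : mkset _ = (fun u : 'rV[R]_n => u 0 i - r * g u) @^-1` [set y | 0 <= y]).
    by apply: preimage_closed; [move=> u _; exact: coord_gap_continuous|exact: closed_ge].
  by apply/seteqP; split => u /=; rewrite subr_ge0.
have closed2 i r : closed [set u : 'rV[R]_n | u 0 i <= r * g u].
  rewrite (_ : mkset _ = (fun u : 'rV[R]_n => u 0 i - r * g u) @^-1` [set y | y <= 0]).
    by apply: preimage_closed; [move=> u _; exact: coord_gap_continuous|exact: closed_le].
  by apply/seteqP; split => u /=; rewrite subr_le0.
have mN irr : measurable (N_ irr : set (Borel R n)).
  case: irr => -[i r] r'; rewrite /N_; case: ifP => // _.
  by apply: measurableI; exact: contact_measurable.
have N0 irr : lam (N_ irr) = 0%E.
  have := mN irr; case: irr => -[i r] r'; rewrite /N_; case: ifPn => [rr mm|_ _].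
    apply: lam_ac => //; first by move=> x [[]].
    by apply: sph_outer_double_contact => //; rewrite ltr_rat.
  by rewrite measure0.
exists (\bigcup_k F k).
  split.
    by apply: bigcupT_measurable => k; rewrite /F; case: unpickle.
  by apply: measure_bigcup_null => k; rewrite /F; case: unpickle.
move=> x u u' xS nN uS uS' ux ux'; have S0 : S !=set0 by exists x.
have [a [b hab]] := is_conjf_pinched hconj; have gab := pinched_conjf hab S0.
have sep v w i : S v -> S w -> dotp v x = g v * h x -> dotp w x = g w * h x ->
    w 0 i / g w <= v 0 i / g v.
  move=> vS wS vx wx; rewrite leNgt; apply/negP => vw.
  have gv := pinched_gt0 gab vS; have gw := pinched_gt0 gab wS.
  have [r] := rat_in_itvoo vw; rewrite in_itv/= => /andP[vr rw].
  have [r'] := rat_in_itvoo rw; rewrite in_itv/= => /andP[rr' rw'].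
  apply: nN; exists (pickle (i, r, r')) => //; rewrite /F pickleK /N_.
  rewrite -(ltr_rat R) rr'; split; split => //.
    by exists w => //=; rewrite -ler_pdivlMr// ltW.
  by exists v => //=; rewrite -ler_pdivrMr// ltW.
have gu := pinched_gt0 gab uS; have gu' := pinched_gt0 gab uS'.
(* The boundary points agree, so the directions are proportional; unit length leaves the factors 1
   and -1, and positivity of [g] excludes the latter. *)
have E : u = (g u / g u') *: u'.
  apply/rowP => i; rewrite mxE; have := sep u u' i uS uS' ux ux'.
  have := sep u' u i uS' uS ux' ux => h1 h2.
  have : u 0 i / g u = u' 0 i / g u' by apply/eqP; rewrite eq_le h1 h2.
  by move=> /(congr1 (fun y => g u * y)); rewrite mulrCA divff ?gt_eqF// mulr1 => ->; ring.
have := usphereP uS; rewrite {1 2}E dotpZl dotpZr (usphereP uS') mulr1 -expr2 => /eqP.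
rewrite sqrf_eq1 => /orP[/eqP c1|/eqP c1]; first by rewrite E c1 scale1r.
have : 0 < g u / g u' by rewrite divr_gt0.
by rewrite c1 oppr_gt0 ltr10.
Qed.

End Uniqueness.

Definition density {d} {T : measurableType d} {R : realType}
    (m : {measure set T -> \bar R}) (f : T -> R) (A : set T) : \bar R :=
  (\int[m]_(x in A) (f x)%:E)%E.

(** * Measures with a density *)

Section Density.
Local Open Scope ereal_scope.
Context {d} {T : measurableType d} {R : realType}.
Variables (m : {measure set T -> \bar R}) (f : T -> R).
Hypotheses (mf : measurable_fun setT f) (f0 : forall x, (0 <= f x)%R).

Let density0 : density m f set0 = 0.
Proof. exact: integral_set0. Qed.

Let density_ge0 A : 0 <= density m f A.
Proof. by apply: integral_ge0 => x _; rewrite lee_fin. Qed.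

Let density_sigma_additive : semi_sigma_additive (density m f).
Proof.
move=> F mF tF mUF; rewrite /density ge0_integral_bigcup//.
- apply: is_cvg_ereal_nneg_natsum => k _.
  by apply: integral_ge0 => x _; rewrite lee_fin.
- by apply: measurable_funTS; exact/measurable_EFinP.
- by move=> x _; rewrite lee_fin.
Qed.

HB.instance Definition _ := isMeasure.Build _ _ _
  (density m f) density0 density_ge0 density_sigma_additive.

Definition density_measure : {measure set T -> \bar R} := density m f.

Import HBNNSimple.

Let integral_density_nnsfun (D : set T) (s : {nnsfun T >-> R}) : measurable D ->
  \int[density m f]_(x in D) (s x)%:E = \int[m]_(x in D) ((s x)%:E * (f x)%:E).
Proof.
move=> mD.
have mF k : measurable_fun D (fun x => (k * \1_(s @^-1` [set k]) x)%R%:E).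
  by apply/measurable_EFinP; exact: measurable_funM.
transitivity (\sum_(k \in range s)
    \int[m]_(x in D) ((k * \1_(s @^-1` [set k]) x)%R%:E * (f x)%:E)).
  under eq_integral do rewrite fimfunE -fsumEFin//.
  rewrite ge0_integral_fsum//; last by move=> y x _; rewrite nnfun_muleindic_ge0.
  apply: eq_fsbigr => r _; rewrite integralZl_indic_nnsfun// integral_indic//.
  have [r0|r0] := ltP r 0%R.
    rewrite preimage_nnfun0// set0I measure0 mule0.
    by rewrite integral0_eq// => x _; rewrite indic0 mulr0 mul0e.
  rewrite setIC /= /density integral_mkcondr -ge0_integralZl_EFin//.
  - apply: eq_integral => x _; rewrite /patch indicE.
    by case: ifPn => _; rewrite ?mulr1 ?mulr0 ?mul0e ?mule0 ?EFinM.
  - by move=> x _; rewrite erestrict_ge0// => y _; rewrite lee_fin.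
  - apply/(measurable_restrict _ _ _) => //.
    by apply: measurable_funTS; exact/measurable_EFinP.
rewrite -ge0_integral_fsum//.
- apply: eq_integral => x _; rewrite [in RHS]fimfunE -fsumEFin//.
  by rewrite ge0_mule_fsuml// => k; rewrite nnfun_muleindic_ge0.
- move=> k; apply: emeasurable_funM; first exact: mF.
  by apply: measurable_funTS; exact/measurable_EFinP.
- move=> k x _; apply: mule_ge0; last by rewrite lee_fin.
  by rewrite EFinM nnfun_muleindic_ge0.
Qed.

(** First for simple functions by linearity, then by monotone convergence on both sides. *)
Lemma integral_density (D : set T) (g : T -> R) : measurable D ->
  measurable_fun D g -> (forall x, D x -> (0 <= g x)%R) ->
  \int[density_measure]_(x in D) (g x)%:E = \int[m]_(x in D) ((g x)%:E * (f x)%:E).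
Proof.
move=> mD mg g0; rewrite /density_measure; have mgE : measurable_fun D (EFin \o g) by exact/measurable_EFinP.
pose g_ := nnsfun_approx mD mgE.
have cvg_g x : D x -> (g_ k x)%:E @[k --> \oo] --> (g x)%:E.
  by move=> Dx; apply: (@cvg_nnsfun_approx _ _ _ _ mD _ mgE) => // y Dy; rewrite lee_fin g0.
transitivity (limn (fun k => \int[density m f]_(x in D) (g_ k x)%:E)).
  rewrite -monotone_convergence//.
  - by apply: eq_integral => x /[!inE] Dx; apply/esym/cvg_lim => //; exact: cvg_g.
  - by move=> k; apply: measurable_funTS; exact/measurable_EFinP/measurable_funP.
  - by move=> k x _; rewrite lee_fin.
  - by move=> x _ k l kl; rewrite lee_fin; exact/lefP/nd_nnsfun_approx.
under eq_fun do rewrite integral_density_nnsfun//.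
rewrite -monotone_convergence//.
- apply: eq_integral => x /[!inE] Dx; apply/cvg_lim => //.
  by apply: cvgeZr => //; exact: cvg_g.
- move=> k; apply: emeasurable_funM; apply: measurable_funTS; apply/measurable_EFinP => //.
- by move=> k x _; rewrite mule_ge0 ?lee_fin.
- move=> x _ k l kl; rewrite lee_wpmul2r ?lee_fin//.
  exact/lefP/nd_nnsfun_approx.
Qed.

End Density.

(** * The body with a given support function *)

Section WulffShape.
Context {R : realType} {n : nat}.
Variable h : 'rV[R]_n -> R.
Hypothesis hconj : is_conjf h.
Local Notation S := (usphere R n).
Local Notation g := (conjf h).

Let K : set 'rV[R]_n := [set y | forall x, S x -> dotp x y <= h x].

Let g_gt0 u : S u -> 0 < g u.
Proof.
move=> uS; have [a [b hab]] := is_conjf_pinched hconj.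
have S0 : S !=set0 by exists u.
exact: pinched_gt0 (pinched_conjf hab S0) uS.
Qed.

Let K_closed : closed K.
Proof.
rewrite (_ : K = \bigcap_(x in S) (dotp x @^-1` [set t | t <= h x])); last first.
  by apply/seteqP; split.
apply: closed_bigI => x _.
by apply: preimage_closed; [move=> y _; exact: dotp_continuousr|exact: closed_le].
Qed.

Lemma dotp_delta (c : R) (i : 'I_n) (y : 'rV[R]_n) :
  dotp (c *: delta_mx 0 i) y = c * y 0 i.
Proof.
rewrite dotpZl dotpE (bigD1 i)//= mxE !eqxx mul1r big1 ?addr0// => j ji.
by rewrite mxE eqxx/= (negbTE ji) mul0r.
Qed.

Lemma wulff_convex_body : convex_body0 K.
Proof.
have [a [b hab]] := is_conjf_pinched hconj; have [a0 hb] := hab.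
split; [|split].
- apply: bounded_closed_compact K_closed.
  exists `|b|; split; first exact: num_real.
  move=> M bM y Ky /=; apply: le_trans (ltW bM).
  apply: norm_le_coord => // i; rewrite (le_trans _ (ler_norm b))//.
  (* [c] is a sign: testing with both orientations of each axis bounds the coordinates. *)
  have dS c : c * c = 1 -> S (c *: delta_mx 0 i).
    by move=> cc; rewrite /usphere/= dotp_delta !mxE !eqxx mulr1.
  have yb c : c * c = 1 -> c * y 0 i <= b.
    move=> cc; have /Ky := dS _ cc; rewrite dotp_delta => /le_trans; apply.
    by have /andP[] := hb _ (dS _ cc).
  have := yb 1; have := yb (- 1); rewrite mulrNN !mul1r mulN1r => h1 h2.
  by rewrite ler_norml lerNl h1 ?h2.
- move=> x y Kx Ky t /andP[t0 t1] z zS; rewrite dotpDr !dotpZr.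
  have := Kx z zS; have := Ky z zS; move: (dotp z x) (dotp z y) (h z) => X Y Z.
  by nra.
- rewrite /interior; have n0 : 0 < n%:R + 1 :> R by rewrite ltr_wpDl.
  apply/nbhs_ballP; exists (a / (n%:R + 1)); first by rewrite /= divr_gt0.
  move=> y; rewrite -ball_normE /= sub0r normrN ltr_pdivlMr// => ya x xS.
  rewrite (le_trans (ler_norm _))// (le_trans (norm_dotp_usphere_le _ xS))//.
  have /andP[ah _] := hb _ xS; apply: le_trans ah; apply: le_trans (ltW ya).
  by rewrite mulrC ler_wpM2l// lerDl.
Qed.

(** The point [t *: u] lies in [K] iff every quotient [dotp x u / h x] is at most [1 / t], and
    [conjf h u] is the supremum of these quotients. *)
Lemma wulff_ray (u : 'rV[R]_n) (t : R) : S u -> 0 < t -> K (t *: u) <-> t <= (g u)^-1.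
Proof.
move=> uS t0; have g0 := g_gt0 uS; have [a [b hab]] := is_conjf_pinched hconj.
split => [Ktu|tg x xS]; last first.
  rewrite dotpZr dotpC (@le_trans _ _ (t * (g u * h x)))//.
    by rewrite ler_wpM2l ?(ltW t0)// young.
  rewrite mulrA ler_piMl ?(ltW (pinched_gt0 hab xS))//.
  by move: tg; rewrite -div1r ler_pdivlMr.
rewrite -[leLHS]invrK lef_pV2 ?posrE ?invr_gt0//.
apply: conjf_le; first by exists u.
move=> x xS; have h0 := pinched_gt0 hab xS.
rewrite ler_pdivrMr// mulrC ler_pdivlMr// mulrC -dotpZr.
exact: Ktu.
Qed.

Lemma radialf_wulff (u : 'rV[R]_n) : S u -> radialf K u = (g u)^-1.
Proof.
move=> uS; have gi0 : 0 < (g u)^-1 by rewrite invr_gt0 g_gt0.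
have ub t : 0 < t /\ K (t *: u) -> t <= (g u)^-1.
  by move=> [t0 /(wulff_ray uS t0)].
have mem : 0 < (g u)^-1 /\ K ((g u)^-1 *: u).
  by split => //; apply/(wulff_ray uS gi0).
apply/eqP; rewrite eq_le; apply/andP; split.
  by apply: ge_sup; [exists (g u)^-1|exact: ub].
by apply: ub_le_sup => //; exists (g u)^-1; exact: ub.
Qed.

Lemma supportf_wulff (x : 'rV[R]_n) : S x -> supportf K x = h x.
Proof.
(* The support function is attained at the boundary point in a contact direction of [x]. *)
move=> xS; have [_ [u _ [uS ux]]] := contact_setT hconj xS.
have g0 := g_gt0 uS; have gi0 : 0 < (g u)^-1 by rewrite invr_gt0.
have mem : [set dotp y x | y in K] (h x).
  exists ((g u)^-1 *: u); first exact/(wulff_ray uS gi0).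
  by rewrite dotpZl ux mulKf// gt_eqF.
have ub : ubound [set dotp y x | y in K] (h x).
  by move=> _ [y Ky <-]; rewrite dotpC; exact: Ky.
apply/eqP; rewrite /supportf eq_le; apply/andP; split.
  by apply: ge_sup; [exists (h x); exact: mem|exact: ub].
by apply: ub_le_sup; [exists (h x)|exact: mem].
Qed.

Lemma rgauss_wulff (w : set 'rV[R]_n) : rgauss K (w `&` S) = contact h w.
Proof.
apply/seteqP; split => x [xS].
  move=> [u [wu uS]]; rewrite radialf_wulff// supportf_wulff// dotpZl => ux.
  split => //; exists u => //; split => //.
  by rewrite -ux mulrA divff ?mul1r// gt_eqF// g_gt0.
move=> [u wu [uS ux]]; split => //; exists u => //.
by rewrite radialf_wulff// supportf_wulff// dotpZl ux mulKf// gt_eqF// g_gt0.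
Qed.

End WulffShape.

(** * The Gauss image measure of the minimizer *)

Section ReverseMap.
Context {R : realType} {n : nat}.
Local Notation S := (usphere R n).

(** Points at distance at least [k.+1%:R^-1] from the complement. The lemma carries an inequality
    from closed sets to open ones by continuity from below. *)
Lemma open_Fsigma (O : set 'rV[R]_n) : open O -> exists F : nat -> set 'rV[R]_n,
  [/\ forall k, closed (F k), nondecreasing_seq F & \bigcup_k F k = O].
Proof.
move=> oO.
exists (fun k => \bigcap_(y in ~` O) [set x : 'rV[R]_n | k.+1%:R^-1 <= `|x - y|]); split.
- move=> k; apply: closed_bigI => y _.
  rewrite (_ : mkset _ = (fun x : 'rV[R]_n => `|x - y|) @^-1` [set t | k.+1%:R^-1 <= t])//.
  apply: preimage_closed; last exact: closed_ge.
  move=> x _; apply: (@lipschitz_continuous _ _ (fun x : 'rV[R]_n => `|x - y|) 1) => v w.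
  rewrite mul1r; have := lerB_dist (v - y) (w - y); have := lerB_dist (w - y) (v - y).
  rewrite !opprB !addrA !subrK (distrC w v) => h1 h2.
  by rewrite ler_norml h2 andbT lerNl opprB.
- move=> k l kl; apply/subsetPset => x Fx y Oy; apply: le_trans (Fx y Oy).
  by rewrite lef_pV2 ?posrE// ler_nat.
apply/seteqP; split => [x [k _ Fx]|x Ox].
  apply: contrapT => nOx; have /= := Fx x nOx.
  by rewrite subrr normr0 leNgt invr_gt0 ltr0n.
have /nbhs_ballP[e /= e0 eO] : nbhs x O by exact: open_nbhs_nbhs.
exists (Num.bound e^-1) => // y nOy /=; rewrite leNgt; apply/negP => xy.
apply: nOy; apply: eO; rewrite -ball_normE /=; apply: lt_trans xy _.
rewrite invf_plt ?posrE//.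
have := archi_boundP (ltW (_ : 0 < e^-1)); rewrite invr_gt0 => /(_ e0) /lt_le_trans; apply.
by rewrite ler_nat.
Qed.

Variables (lam mu : {measure set (Borel R n) -> \bar R}) (p : R).
Hypothesis p0 : 0 < p.
Hypotheses (lam_fin : (lam setT < +oo)%E) (mu_fin : (mu setT < +oo)%E).
Hypotheses (lam_sph : lam (~` S) = 0%E) (mu_sph : mu (~` S) = 0%E).
Hypothesis lam_ac : forall w : set (Borel R n), measurable w -> w `<=` S ->
     sph_outer R n w = 0%E -> lam w = 0%E.
Variable h : 'rV[R]_n -> R.
Hypothesis hconj : is_conjf h.
Hypothesis hmin : forall h', is_conjf h' -> energy lam mu p h <= energy lam mu p h'.
Local Notation g := (conjf h).
Let f : Borel R n -> R := fun u => g u `^ p.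

Lemma minimizer_density_measurable : measurable_fun setT f.
Proof.
apply: (measurableT_comp (measurable_powR p)).
by apply: continuous_measurable_Borel; exact: is_conjf_conjf_continuous.
Qed.

Let f0 x : 0 <= f x. Proof. exact: powR_ge0. Qed.
Let mf := minimizer_density_measurable.
Let nu := density mu f.

Lemma null_off_usphere (m : {measure set (Borel R n) -> \bar R}) (A : set (Borel R n)) :
  m (~` S) = 0%E -> measurable A -> m A = m (S `&` A).
Proof.
move=> m0 mA; have mS := @usphere_measurable R n.
rewrite (measureDI m mA mS) setIC [X in (X + _)%E](_ : _ = 0%E) ?add0e//.
apply/eqP; rewrite -measure_le0 -m0; apply: le_measure; rewrite ?inE.
- exact: measurableD.
- exact: measurableC.
- by move=> x [].
Qed.

Lemma density_mass (A : set (Borel R n)) : measurable A ->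
  nu A = (\int[mu]_(u in S `&` A) f u)%:E.
Proof.
move=> mA; have mS := @usphere_measurable R n.
have nu0 : nu (~` S) = 0%E.
  rewrite /nu /density null_set_integral//; first exact: measurableC.
  by apply: measurable_funTS; exact/measurable_EFinP.
have -> : nu A = nu (S `&` A) by exact: (@null_off_usphere (density mu f) A nu0 mA).
rewrite /Rintegral fineK//; have [S0|/set0P/negP/negPn/eqP S0] := pselect (S !=set0); last first.
  by rewrite S0 set0I integral_set0.
have [a [b hab]] := is_conjf_pinched hconj.
have gi := integrable_powR mu_fin p0 (pinched_conjf hab S0)
  (continuous_measurable_Borel (conjf_continuous hab)).
have mSA : measurable (S `&` A : set (Borel R n)) by exact: measurableI.
apply: integrable_fin_num => //; exact: integrableS gi.
Qed.

(* The a.e. defined inverse of the radial Gauss map transports [lam] to [nu]. *)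
Lemma gauss_image_minimizer (w : set (Borel R n)) : measurable w ->
  nu w = mouter lam (contact h w).
Proof.
have mS := @usphere_measurable R n.
have [N [mN lN0] uniqN] := unique_contact lam_ac hconj.
pose W : set (Borel R n) := S `\` N.
have mW : measurable W by exact: measurableD.
(* Off the set [W] of full measure the value is the constant 0, so the complement of [W] enters a
   preimage entirely or not at all. *)
pose T (x : Borel R n) : Borel R n := if x \in W then
  xget 0 [set u | S u /\ dotp u x = g u * h x] else 0.
have TW x : W x -> S (T x) /\ dotp (T x) x = g (T x) * h x.
  move=> Wx; rewrite /T mem_set//; have [xS _] := Wx.
  have [_ [u _ ux]] := contact_setT hconj xS.
  by have := xgetPex 0 (ex_intro (fun u => S u /\ dotp u x = g u * h x) u ux).
have contactT x C : W x -> contact h C x <-> C (T x).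
  move=> Wx; have [xS nN] := Wx; have [TS Tx] := TW _ Wx; split => [|CT].
    by move=> [_ [u Cu [uS ux]]]; rewrite (uniqN x (T x) u).
  by split => //; exists (T x).
have mT : measurable_fun setT T.
  apply: (@measurability _ _ (Borel R n) (Borel R n) setT T (@open 'rV[R]_n)) => // _ [U oU <-]; rewrite setTI.
  (* On [W] the contact direction is unique, so [T x] lies in [U] exactly when [x] has no contact in
     the closed complement of [U]. *)
  rewrite (_ : T @^-1` U = (W `\` contact h (~` U)) `|`
      (~` W `&` [set _ | U 0])); last first.
    apply/seteqP; split => x /=.
      have [Wx TU|Wx] := pselect (W x).
        by left; split => // /(contactT _ _ Wx).
      by rewrite /T memNset// => U0; right.
    move=> [[Wx nc]|[nW U0]]; last by rewrite /T memNset.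
    by apply: contrapT => nU; apply: nc; apply/(contactT _ _ Wx).
  apply: measurableU.
    apply: measurableD => //; apply: contact_measurable => //.
    exact: open_closedC.
  have [U0|U0] := pselect (U (0 : 'rV[R]_n)).
    rewrite (_ : mkset _ = setT) ?setIT; first exact: measurableC.
    by apply/seteqP; split.
  rewrite (_ : mkset _ = set0) ?setI0; first exact: measurable0.
  by apply/seteqP; split.
have WC0 : lam (~` W) = 0%E.
  have W_E : ~` W = ~` S `|` N by rewrite /W setCD.
  have : (lam (~` S `|` N) <= lam (~` S) + lam N)%E.
    by apply: measureU2 => //; exact: measurableC.
  by rewrite lam_sph lN0 adde0 measure_le0 W_E => /eqP.
have lamW A : measurable A -> lam A = lam (W `&` A).
  move=> mA; rewrite (measureDI lam mA mW) setIC [X in (X + _)%E](_ : _ = 0%E) ?add0e//.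
  apply/eqP; rewrite -measure_le0 -WC0; apply: le_measure; rewrite ?inE.
  - exact: measurableD.
  - exact: measurableC.
  - by move=> x [].
have mTA A : measurable A -> measurable (T @^-1` A).
  by move=> mA; rewrite -[_ @^-1` _]setTI; exact: mT.
pose nuT : set (Borel R n) -> \bar R := pushforward lam T.
(* The first variation gives [nuT <= nu] on open sets, the mass comparison the reverse on the whole
   space. Subtraction gives [nu <= nuT] on closed sets, and these exhaust open sets. *)
have nu_open O : open O -> nuT O = nu O.
  have le_open U : open U -> (nuT U <= nu U)%E.
    move=> oU; have mU := open_measurable_Borel oU.
    rewrite density_mass//; have := complement_contact_le p0 lam_fin mu_fin hconj hmin oU.
    have mc : measurable (S `\` contact h (~` U) : set (Borel R n)).
      by apply: measurableD => //; apply: contact_measurable => //; exact: open_closedC.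
    rewrite -lee_fin fineK ?finite_Borel_fin_num//; apply: le_trans.
    rewrite /nuT /pushforward lamW; last exact: mTA.
    apply: le_measure; rewrite ?inE.
    - by apply: measurableI => //; exact: mTA.
    - exact: mc.
    - by move=> x [Wx TU]; split; [case: Wx|move/(contactT _ _ Wx)].
  have tot : (nu setT <= nuT setT)%E.
    rewrite density_mass// /nuT /pushforward preimage_setT.
    have := minimizer_mass_le p0 lam_fin mu_fin hconj hmin.
    rewrite -lee_fin (fineK (finite_Borel_fin_num lam_fin mS)) => /le_trans; apply.
    by apply: le_measure; rewrite ?inE.
  have fin_nu A : measurable A -> nu A \is a fin_num by move=> mA; rewrite density_mass.
  have fin_nuT A : measurable A -> nuT A \is a fin_num.
    by move=> mA; rewrite finite_Borel_fin_num//; exact: mTA.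
  have ge_closed C : closed C -> (nu C <= nuT C)%E.
    move=> cC; have mC := closed_measurable_Borel cC.
    have mCC : measurable (~` C : set (Borel R n)) by exact: measurableC.
    have h1 : (nu setT = nu C + nu (~` C))%E.
      by rewrite -(setUv C); apply: (measureU (density mu f)) => //; rewrite setICr.
    have h2 : (nuT setT = nuT C + nuT (~` C))%E.
      rewrite -(setUv C) /nuT /pushforward preimage_setU measureU//; try exact: mTA.
      by rewrite -preimage_setI setICr preimage_set0.
    have h3 := le_open _ (closed_openC cC); move: tot h3; rewrite h1 h2.
    rewrite -(fineK (fin_nu _ mC)) -(fineK (fin_nu _ mCC)).
    rewrite -(fineK (fin_nuT _ mC)) -(fineK (fin_nuT _ mCC)) -!EFinD !lee_fin.
    move: (fine (nu C)) (fine (nu _)) (fine (nuT C)) (fine (nuT _)) => *; lra.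
  move=> oO; apply/eqP; rewrite eq_le le_open//=.
  have [F [cF ndF FO]] := open_Fsigma oO.
  have mO := open_measurable_Borel oO.
  have mF k : measurable (F k : set (Borel R n)) by exact: closed_measurable_Borel.
  have cvgF : nu (F k) @[k --> \oo] --> nu O.
    rewrite -FO; apply: (nondecreasing_cvg_mu (mu := density mu f)) => //.
    by rewrite FO.
  have -> : nu O = limn (fun k => nu (F k)) by apply/esym/cvg_lim.
  apply: lime_le; first by apply/cvg_ex; eexists; exact: cvgF.
  near=> k; apply: (le_trans (ge_closed _ (cF k))).
  rewrite /nuT /pushforward; apply: le_measure; rewrite ?inE.
  - exact: mTA.
  - exact: mTA.
  - by move=> x /= Fx; rewrite -FO; exists k.
move=> mw.
have <- : nuT w = nu w.
  apply: (@measure_unique _ R (Borel R n) (@open 'rV[R]_n) (fun=> setT) _ _ _ _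
    (pushforward lam T) (density mu f)) => //.
  - by move=> A B oA oB; exact: openI.
  - by move=> _; exact: openT.
  - by rewrite bigcup_const//; exists 0%N.
(* [contact h w] contains this set and is contained in its union with the null complement of [W], so
   its outer measure is the measure of this set. *)
have mWT : measurable (W `&` T @^-1` w) by apply: measurableI => //; exact: mTA.
rewrite /nuT /pushforward lamW; last exact: mTA.
apply/eqP; rewrite eq_le; apply/andP; split.
  apply: le_ereal_inf_tmp => _ [B [mB cB] <-]; apply: le_measure; rewrite ?inE//.
  by move=> x [Wx Tx]; apply: cB; exact/(contactT _ _ Wx).
apply: ereal_inf_lbound; exists ((W `&` T @^-1` w) `|` ~` W).
  split; first by apply: measurableU => //; exact: measurableC.
  move=> x cx; have [Wx|] := pselect (W x); last by right.
  by left; split => //; exact/(contactT _ _ Wx).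
have -> : (lam ((W `&` T @^-1` w) `|` ~` W) = lam (W `&` T @^-1` w) + lam (~` W))%E.
  by apply: measureU => //; [exact: measurableC|rewrite setIAC setICr set0I].
by rewrite WC0 adde0.
Unshelve. all: by end_near. Qed.

End ReverseMap.

(** * The Wulff shape of the minimizer and its Gauss image measure *)

Theorem theorem1p1 (R : realType) (n : nat) (p : R) (hp : 0 < p)
  (lam mu : {measure set (Borel R n) -> \bar R})
  (* lam and mu are finite Borel measures on S^{n-1} *)
  (lam_fin : (lam setT < +oo)%E) (mu_fin : (mu setT < +oo)%E)
  (lam_sph : lam (~` usphere R n) = 0%E) (mu_sph : mu (~` usphere R n) = 0%E)
  (* (1) absolute continuity w.r.t. spherical Lebesgue measure *)
  (lam_ac : forall w : set (Borel R n), measurable w -> w `<=` usphere R n ->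
     sph_outer R n w = 0%E -> lam w = 0%E)
  (* (2) positive on nonempty open subsets of the usphere *)
  (lam_open : forall O : set 'rV[R]_n, open O -> usphere R n `&` O !=set0 ->
     (0 < lam (usphere R n `&` O))%E)
  (* (3) mu not concentrated in any closed hemisphere *)
  (mu_hemi : forall v : 'rV[R]_n, usphere R n v ->
     (0 < mu (usphere R n `&` [set x | (dotp x v < 0)%R]))%E) :
  exists K : set 'rV[R]_n, convex_body0 K /\
    (* the Gauss image measure lambda(K, .) is a Borel measure ... *)
    exists nu : {measure set (Borel R n) -> \bar R},
      (forall w : set (Borel R n), measurable w ->
         nu w = gauss_image_measure lam K (w `&` usphere R n)) /\
      (* ... and mu = lambda_p(K, .), i.e. d mu = rho_K^p d lambda(K, .) *)
      (forall w : set (Borel R n), measurable w ->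
         mu w = (\int[nu]_(x in w `&` usphere R n) ((radialf K x) `^ p)%:E)%E).
Proof.
have lam_pos v : usphere R n v ->
    (0 < lam (usphere R n `&` [set x | (0 < dotp x v)%R]))%E.
  move=> vS; apply: lam_open; last by exists v; split => //=; rewrite usphereP// ltr01.
  rewrite (_ : mkset _ = dotp v @^-1` [set t | 0 < t]); last first.
    by apply/seteqP; split => x /=; rewrite dotpC.
  by apply: open_comp => [x _|]; [exact: dotp_continuousr|exact: open_gt].
have mu_pos v : usphere R n v ->
    (0 < mu (usphere R n `&` [set x | (0 < dotp x v)%R]))%E.
  move=> vS; have negE x : dotp x (- v) = - dotp x v by rewrite -scaleN1r dotpZr mulN1r.
  have := mu_hemi (- v); rewrite (_ : [set x | dotp x (- v) < 0] = [set x | 0 < dotp x v]).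
    by apply; rewrite /usphere/= negE dotpC negE opprK.
  by apply/seteqP; split => x /=; rewrite negE oppr_lt0.
have mS := @usphere_measurable R n.
have [h hconj hmin] := energy_minimizer hp lam_fin mu_fin lam_pos mu_pos.
pose f (u : Borel R n) := conjf h u `^ p.
have mf : measurable_fun setT f := minimizer_density_measurable p hconj.
have f0 u : 0 <= f u by exact: powR_ge0.
exists [set y | forall x, usphere R n x -> dotp x y <= h x].
split; first exact: wulff_convex_body.
(* Taken as [g^p mu], a measure by construction; the Gauss image measure is then identified by its
   values, and integrating [rho_K^p = g^(-p)] undoes the density. *)
pose nu := density_measure mu mf f0.
exists nu; split => w mw.
  rewrite /gauss_image_measure rgauss_wulff//.
  exact: (gauss_image_minimizer hp lam_fin mu_fin lam_sph mu_sph lam_ac hconj hmin mw).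
have mwS : measurable (w `&` usphere R n : set (Borel R n)) by exact: measurableI.
have g0 x : usphere R n x -> 0 < conjf h x.
  move=> xS; have [a [b hab]] := is_conjf_pinched hconj.
  have S0 : usphere R n !=set0 by exists x.
  exact: pinched_gt0 (pinched_conjf hab S0) xS.
rewrite (null_off_usphere mu_sph mw) setIC.
transitivity (\int[nu]_(x in w `&` usphere R n) (conjf h x `^ (- p))%:E)%E; last first.
  apply: eq_integral => x /[!inE] -[_ xS]; rewrite radialf_wulff//.
  by rewrite -(powR_inv1 (ltW (g0 x xS))) -powRrM mulN1r.
rewrite integral_density//; first last.
- by move=> x _; exact: powR_ge0.
- by apply: measurable_funTS; exact: minimizer_density_measurable.
rewrite (@eq_integral _ _ _ mu _ (cst 1%E)) => [|x /[!inE] -[_ xS]]; last first.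
  by rewrite -EFinM /f powRN mulVf// gt_eqF// powR_gt0// g0.
by rewrite integral_cst// mul1e.
Qed.
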